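(* Let $c,d$ be positive integers and let $A=k[x_1,\ldots,x_d]^{(c)}$ be the Veronese subring, where $k$ is a field of characteristic $p>0$. Let $\mathfrak m$ be the unique homogeneous maximal ideal of $A$. If $d\ge3$ and $c\ge\frac{d(d-1)}2$, then $$e_{HK}(R(\mathfrak m))\le\frac{2^{d+1}}{(d+1)!}\,c^{d-1}<c^{d-1}=e(A).$$ In fact, for a fixed integer $d\ge3$, $$\lim_{c\to\infty}\frac{e_{HK}(R(\mathfrak m))}{e(A)}=\frac{2^{d+1}-2}{(d+1)!}.$$
   Context: $k[x_1,\ldots,x_d]^{(c)}$ is the $k$-subalgebra of $k[x_1,\ldots,x_d]$ generated by all monomials of degree $c$; its homogeneous maximal ideal $\mathfrak m$ is generated by these monomials. $R(\mathfrak m)=\bigoplus_{n\ge0}\mathfrak m^nt^n=A[\mathfrak mt]$ is the Rees algebra, with homogeneous maximal ideal $\mathfrak M=(\mathfrak m,\mathfrak mt)$, and $e_{HK}(R(\mathfrak m)):=e_{HK}(R(\mathfrak m)_{\mathfrak M})$, where for a Noetherian local ring $(B,\mathfrak n)$ of characteristic $p>0$, $e_{HK}(B)=\lim_{e\to\infty}l_B(B/\mathfrak n^{[q]})/q^{\dim B}$ with $q=p^e$, $l$ denoting length and $\mathfrak n^{[q]}$ the ideal generated by the $q$-th powers of elements of $\mathfrak n$. $e(A)=\lim_{n\to\infty}\frac{d!}{n^d}l_A(A/\mathfrak m^n)$ is the usual multiplicity of $A$ with respect to $\mathfrak m$. *)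

(* Defs.v *)
From HB Require Import structures.
From mathcomp Require Import all_boot all_order all_algebra.
From mathcomp Require Import generic_quotient ring_quotient.
From mathcomp Require Import ring.
From mathcomp Require mpoly.
From mathcomp Require Import boolp classical_sets reals topology normedtype.
From mathcomp Require Import sequences.

Set Implicit Arguments.
Unset Strict Implicit.
Unset Printing Implicit Defensive.

(* the notations of mpoly clash with those of mathcomp-analysis *)
Import -(notations) mpoly.
Import Order.TTheory GRing.Theory Num.Theory numFieldNormedType.Exports.

Local Open Scope classical_set_scope.
Local Open Scope ring_scope.
Local Open Scope quotient_scope.

(* Ideals of a commutative ring R are the submodules of R^o, i.e. the objects *)
(* of type submodClosed R^o; prime ideals have the library type               *)
(* prime_idealr R.                                                            *)

Section GeneratedIdeals.
Variable R : comNzRingType.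

Definition ideal_gen (G : set R) : {pred R^o} :=
  [pred x : R^o | `[< exists n (a g : 'I_n -> R),
    (forall i, G (g i)) /\ x = \sum_i a i * g i >]].

Lemma ideal_genP (G : set R) (x : R) :
  reflect (exists n (a g : 'I_n -> R),
    (forall i, G (g i)) /\ x = \sum_i a i * g i) (x \in ideal_gen G).
Proof. exact: asboolP. Qed.

Lemma ideal_gen_submod (G : set R) : submod_closed (ideal_gen G).
Proof.
split.
  apply/ideal_genP; exists 0%N, (fun=> 0), (fun=> 0).
  by split=> [[]//|]; rewrite big_ord0.
move=> b x y /ideal_genP[n [a [g [Gg ->]]]] /ideal_genP[m [a' [g' [Gg' ->]]]].
apply/ideal_genP; exists (n + m)%N.
exists (fun i => match split i with inl j => b * a j | inr j => a' j end).
exists (fun i => match split i with inl j => g j | inr j => g' j end).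
split=> [i|]; first by case: splitP.
rewrite big_split_ord /=; congr (_ + _).
  transitivity (b * \sum_i a i * g i) => //; rewrite mulr_sumr.
  apply: eq_bigr => i _; rewrite mulrA.
  by rewrite (unsplitK (inl i : 'I_n + 'I_m)).
by apply: eq_bigr => i _; rewrite (unsplitK (inr i : 'I_n + 'I_m)).
Qed.

HB.instance Definition _ (G : set R) :=
  GRing.isSubmodClosed.Build R R^o (ideal_gen G) (ideal_gen_submod G).

Lemma mem_ideal_gen (G : set R) (x : R) : G x -> x \in ideal_gen G.
Proof.
move=> Gx; apply/ideal_genP; exists 1%N, (fun=> 1), (fun=> x).
by split=> //; rewrite big_ord1 mul1r.
Qed.

Lemma ideal_genMl (G : set R) (a x : R) :
  x \in ideal_gen G -> a * x \in ideal_gen G.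
Proof. exact: (@rpredZ R R^o (ideal_gen G) a x). Qed.

Definition ideal_exp (I : {pred R}) (n : nat) : submodClosed R^o :=
  ideal_gen [set x | exists2 f : 'I_n -> R, (forall i, f i \in I) &
                       x = \prod_i f i].

Definition frobenius_power (I : {pred R}) (q : nat) : submodClosed R^o :=
  ideal_gen [set x ^+ q | x in [set y | y \in I]].

End GeneratedIdeals.

Section QuotientModule.
Variables (R : pzRingType) (V : lmodType R) (W : submodClosed V).

(* an alias, because submodClosed does not inherit from zmodClosed *)
Definition submod_zmod : {pred V} := W.

Lemma submod_zmod_closed : zmod_closed submod_zmod.
Proof. exact: GRing.submod_closedB (submodClosedP W). Qed.

HB.instance Definition _ :=
  GRing.isZmodClosed.Build V submod_zmod submod_zmod_closed.

Definition quot_mod : Type := Quotient.quot submod_zmod.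

HB.instance Definition _ := GRing.Zmodule.on quot_mod.
HB.instance Definition _ := EqQuotient.on quot_mod.

Definition quot_scale (a : R) (x : quot_mod) : quot_mod :=
  \pi_quot_mod (a *: repr x).

Lemma quot_modE (x y : V) :
  (\pi_quot_mod x == \pi_quot_mod y) = (x - y \in W).
Proof. exact: (esym (Quotient.idealrBE submod_zmod x y)). Qed.

Lemma quot_modW (Q : quot_mod -> Prop) :
  (forall x : V, Q (\pi_quot_mod x)) -> forall x, Q x.
Proof. by move=> H x; rewrite -[x]reprK; exact: H. Qed.

Lemma pi_quotD : {morph \pi_quot_mod : x y / x + y >-> x + y}.
Proof. exact: Quotient.pi_add. Qed.

Lemma pi_quot_scale (a : R) (x : V) :
  quot_scale a (\pi_quot_mod x) = \pi_quot_mod (a *: x).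
Proof.
apply/eqP; rewrite quot_modE -scalerBr.
have [_ Wlin] := submodClosedP W.
rewrite -[_ *: _]addr0 Wlin ?rpred0 // -quot_modE.
by rewrite reprK.
Qed.

Lemma quot_scaleA a b x : quot_scale a (quot_scale b x) = quot_scale (a * b) x.
Proof. by elim/quot_modW: x => x; rewrite !pi_quot_scale scalerA. Qed.

Lemma quot_scale1 : left_id 1 quot_scale.
Proof. by elim/quot_modW=> x; rewrite pi_quot_scale scale1r. Qed.

Lemma quot_scaleDr : right_distributive quot_scale +%R.
Proof.
move=> a; elim/quot_modW=> x; elim/quot_modW=> y.
by rewrite -pi_quotD !pi_quot_scale scalerDr pi_quotD.
Qed.

Lemma quot_scaleDl x : {morph quot_scale^~ x : a b / a + b}.
Proof.
move=> a b; elim/quot_modW: x => x.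
by rewrite !pi_quot_scale scalerDl pi_quotD.
Qed.

HB.instance Definition _ := GRing.Zmodule_isLmodule.Build R quot_mod
  quot_scaleA quot_scale1 quot_scaleDr quot_scaleDl.

End QuotientModule.

Section LengthAndDimension.

Definition submod_chain (B : pzRingType) (M : lmodType B) (n : nat) : Prop :=
  exists N : nat -> submodClosed M, forall i, (i < n)%N ->
    {subset N i <= N i.+1} /\ ~ {subset N i.+1 <= N i}.

Definition has_length (B : pzRingType) (M : lmodType B) (n : nat) : Prop :=
  submod_chain M n /\ forall m, submod_chain M m -> (m <= n)%N.

Definition prime_chain (B : comNzRingType) (n : nat) : Prop :=
  exists P : nat -> prime_idealr B, forall i, (i < n)%N ->
    {subset P i <= P i.+1} /\ ~ {subset P i.+1 <= P i}.

Definition has_krull_dim (B : comNzRingType) (n : nat) : Prop :=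
  prime_chain B n /\ forall m, prime_chain B m -> (m <= n)%N.

End LengthAndDimension.

Section Localization.
Variables (A : comNzRingType) (P : prime_idealr A).

Definition denom : Type := {s : A | s \notin P}.
HB.instance Definition _ := Choice.on denom.

Lemma denom1_subproof : 1 \notin P.
Proof. by rewrite idealr1. Qed.
Definition denom1 : denom := exist _ 1 denom1_subproof.

Lemma denomM_subproof (s t : denom) : sval s * sval t \notin P.
Proof. by rewrite prime_idealrM negb_or (svalP s) (svalP t). Qed.
Definition denomM (s t : denom) : denom :=
  exist _ (sval s * sval t) (denomM_subproof s t).

Definition fracs : Type := (A * denom)%type.
HB.instance Definition _ := Choice.on fracs.

Definition frac_equiv (x y : fracs) : bool :=
  `[< exists u : denom,
        sval u * (x.1 * sval y.2) = sval u * (y.1 * sval x.2) >].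

Lemma frac_equivP (x y : fracs) : reflect (exists u : denom,
  sval u * (x.1 * sval y.2) = sval u * (y.1 * sval x.2)) (frac_equiv x y).
Proof. exact: asboolP. Qed.

Lemma frac_equiv_class : equiv_class_of frac_equiv.
Proof.
split=> [x|x y|y x z].
- by apply/frac_equivP; exists denom1.
- by apply/frac_equivP/frac_equivP => -[u e]; exists u.
move=> /frac_equivP[u e] /frac_equivP[v f]; apply/frac_equivP.
exists (denomM (denomM u v) y.2) => /=.
transitivity ((sval v * sval z.2) * (sval u * (x.1 * sval y.2))); first by ring.
rewrite e.
transitivity ((sval u * sval x.2) * (sval v * (y.1 * sval z.2))); first by ring.
by rewrite f; ring.
Qed.

Canonical frac_equiv_rel := EquivRelPack frac_equiv_class.
Canonical frac_encModRel := defaultEncModRel frac_equiv.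

Definition localization : Type := {eq_quot frac_equiv}.
HB.instance Definition _ := EqQuotient.on localization.
HB.instance Definition _ := Choice.on localization.

Definition mk_frac (a : A) (s : denom) : localization :=
  \pi_localization ((a, s) : fracs).

Lemma mk_frac_eqP (a b : A) (s t : denom) :
  reflect (exists u : denom, sval u * (a * sval t) = sval u * (b * sval s))
    (mk_frac a s == mk_frac b t).
Proof.
have -> : (mk_frac a s == mk_frac b t) = frac_equiv (a, s) (b, t).
  exact: (@eqquotE _ _ localization (a, s) (b, t)).
exact (frac_equivP (a, s) (b, t)).
Qed.

Lemma mk_frac_eq (a b : A) (s t u : denom) :
  sval u * (a * sval t) = sval u * (b * sval s) -> mk_frac a s = mk_frac b t.
Proof. by move=> e; apply/eqP/mk_frac_eqP; exists u. Qed.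

Lemma mk_fracW (Q : localization -> Prop) :
  (forall a s, Q (mk_frac a s)) -> forall x : localization, Q x.
Proof.
by move=> H x; rewrite -[x]reprK; case: (repr x) => a s; exact: H.
Qed.

Definition loc_add (x y : localization) : localization :=
  mk_frac ((repr x).1 * sval (repr y).2 + (repr y).1 * sval (repr x).2)
          (denomM (repr x).2 (repr y).2).

Definition loc_mul (x y : localization) : localization :=
  mk_frac ((repr x).1 * (repr y).1) (denomM (repr x).2 (repr y).2).

Definition loc_opp (x : localization) : localization :=
  mk_frac (- (repr x).1) (repr x).2.

Definition loc_zero : localization := mk_frac 0 denom1.
Definition loc_one : localization := mk_frac 1 denom1.

Lemma repr_frac (a : A) (s : denom) :
  exists u : denom, sval u * ((repr (mk_frac a s)).1 * sval s) =
                    sval u * (a * sval (repr (mk_frac a s)).2).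
Proof.
apply/mk_frac_eqP; rewrite /mk_frac -surjective_pairing.
by apply/eqP; exact: reprK.
Qed.

Lemma loc_addE (a b : A) (s t : denom) :
  loc_add (mk_frac a s) (mk_frac b t) =
  mk_frac (a * sval t + b * sval s) (denomM s t).
Proof.
have [u e] := repr_frac a s; have [v f] := repr_frac b t.
rewrite /loc_add; move: (repr (mk_frac a s)) (repr (mk_frac b t)) e f.
move=> [a' s'] [b' t'] /= e f; apply: (@mk_frac_eq _ _ _ _ (denomM u v)) => /=.
transitivity (sval v * sval t' * sval t * (sval u * (a' * sval s)) +
              sval u * sval s' * sval s * (sval v * (b' * sval t))); first by ring.
by rewrite e f; ring.
Qed.

Lemma loc_mulE (a b : A) (s t : denom) :
  loc_mul (mk_frac a s) (mk_frac b t) = mk_frac (a * b) (denomM s t).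
Proof.
have [u e] := repr_frac a s; have [v f] := repr_frac b t.
rewrite /loc_mul; move: (repr (mk_frac a s)) (repr (mk_frac b t)) e f.
move=> [a' s'] [b' t'] /= e f; apply: (@mk_frac_eq _ _ _ _ (denomM u v)) => /=.
transitivity ((sval u * (a' * sval s)) * (sval v * (b' * sval t))); first by ring.
by rewrite e f; ring.
Qed.

Lemma loc_oppE (a : A) (s : denom) : loc_opp (mk_frac a s) = mk_frac (- a) s.
Proof.
have [u e] := repr_frac a s.
rewrite /loc_opp; move: (repr (mk_frac a s)) e => [a' s'] /= e.
by apply: (@mk_frac_eq _ _ _ _ u); rewrite !mulNr !mulrN e.
Qed.

Lemma loc_addA : associative loc_add.
Proof.
elim/mk_fracW=> a s; elim/mk_fracW=> b t; elim/mk_fracW=> c r.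
by rewrite !loc_addE; apply: (@mk_frac_eq _ _ _ _ denom1) => /=; ring.
Qed.

Lemma loc_addC : commutative loc_add.
Proof.
elim/mk_fracW=> a s; elim/mk_fracW=> b t.
by rewrite !loc_addE; apply: (@mk_frac_eq _ _ _ _ denom1) => /=; ring.
Qed.

Lemma loc_add0 : left_id loc_zero loc_add.
Proof.
elim/mk_fracW=> a s.
by rewrite loc_addE; apply: (@mk_frac_eq _ _ _ _ denom1) => /=; ring.
Qed.

Lemma loc_addN : left_inverse loc_zero loc_opp loc_add.
Proof.
elim/mk_fracW=> a s.
by rewrite loc_oppE loc_addE; apply: (@mk_frac_eq _ _ _ _ denom1) => /=; ring.
Qed.

HB.instance Definition _ := GRing.isZmodule.Build localization
  loc_addA loc_addC loc_add0 loc_addN.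

Lemma loc_mulA : associative loc_mul.
Proof.
elim/mk_fracW=> a s; elim/mk_fracW=> b t; elim/mk_fracW=> c r.
by rewrite !loc_mulE; apply: (@mk_frac_eq _ _ _ _ denom1) => /=; ring.
Qed.

Lemma loc_mulC : commutative loc_mul.
Proof.
elim/mk_fracW=> a s; elim/mk_fracW=> b t.
by rewrite !loc_mulE; apply: (@mk_frac_eq _ _ _ _ denom1) => /=; ring.
Qed.

Lemma loc_mul1 : left_id loc_one loc_mul.
Proof.
elim/mk_fracW=> a s.
by rewrite loc_mulE; apply: (@mk_frac_eq _ _ _ _ denom1) => /=; ring.
Qed.

Lemma loc_mulDl : left_distributive loc_mul loc_add.
Proof.
elim/mk_fracW=> a s; elim/mk_fracW=> b t; elim/mk_fracW=> c r.
rewrite loc_addE !loc_mulE loc_addE.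
by apply: (@mk_frac_eq _ _ _ _ denom1) => /=; ring.
Qed.

Lemma loc_one_neq0 : loc_one != loc_zero.
Proof.
apply/negP => /mk_frac_eqP[[u Pu] /=]; rewrite !mulr1 mulr0 => u0.
by move: Pu; rewrite u0 idealr0.
Qed.

HB.instance Definition _ := GRing.Zmodule_isComNzRing.Build localization
  loc_mulA loc_mulC loc_mul1 loc_mulDl loc_one_neq0.

(* the maximal ideal P A_P of A_P *)
Definition loc_max : {pred localization} :=
  ideal_gen [set mk_frac a denom1 | a in [set a | a \in P]].

Lemma mem_loc_max (a : A) (s : denom) :
  (mk_frac a s \in loc_max) = (a \in P).
Proof.
apply/idP/idP => [/ideal_genP[n [b [g [Gg e]]]] | Pa].
  have [h hP] : {h : 'I_n -> A | forall i, h i \in P /\ g i = mk_frac (h i) denom1}.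
    have /choice[h hP] i : exists a, a \in P /\ g i = mk_frac a denom1.
      by have [a' Pa' <-] := Gg i; exists a'.
    by exists h.
  have key m (b' g' : 'I_m -> localization) (h' : 'I_m -> A) :
      (forall i, h' i \in P /\ g' i = mk_frac (h' i) denom1) ->
      exists2 c, c \in P & exists t, \sum_i b' i * g' i = mk_frac c t.
    elim: m b' g' h' => [|m IH] b' g' h' h'P.
      by rewrite big_ord0; exists 0; [exact: idealr0|exists denom1].
    rewrite big_ord_recl.
    have [c Pc [t ->]] := IH (fun i => b' (lift ord0 i))
      (fun i => g' (lift ord0 i)) (fun i => h' (lift ord0 i))
      (fun i => h'P (lift ord0 i)).
    have [Ph0 ->] := h'P ord0.
    elim/mk_fracW: (b' ord0) => v r.
    exists (v * h' ord0 * sval t + c * sval (denomM r denom1)).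
      by rewrite rpredD // mulrC !idealMr.
    exists (denomM (denomM r denom1) t).
    transitivity (loc_add (loc_mul (mk_frac v r) (mk_frac (h' ord0) denom1))
      (mk_frac c t)) => //.
    by rewrite loc_mulE loc_addE.
  have [c Pc [t et]] := key _ b g h hP.
  move: e; rewrite et => /eqP/mk_frac_eqP[u eu].
  have : sval u * (a * sval t) \in P.
    by rewrite eu mulrCA mulrC idealMr // idealMr // mulrC idealMr.
  by rewrite !prime_idealrM (negPf (svalP u)) (negPf (svalP t)) orbF.
have -> : mk_frac a s = mk_frac 1 s * mk_frac a denom1.
  rewrite [RHS](loc_mulE 1 a s denom1).
  by apply: (@mk_frac_eq _ _ _ _ denom1) => /=; ring.
by apply: ideal_genMl; apply: mem_ideal_gen; exists a.
Qed.

Lemma loc_max_unit (x : localization) :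
  (x \notin loc_max) <-> exists y, y * x = 1.
Proof.
elim/mk_fracW: x => a s; rewrite mem_loc_max; split=> [Pa | [y]].
  exists (mk_frac (sval s) (exist _ a Pa)).
  rewrite [LHS]loc_mulE; apply: (@mk_frac_eq _ _ _ _ denom1) => /=; ring.
elim/mk_fracW: y => b t; rewrite [X in X = _]loc_mulE.
move=> /eqP/mk_frac_eqP[u /= eu]; apply/negP => Pa.
have : sval u * (1 * (sval t * sval s)) \in P.
  by rewrite -eu mulr1 mulrC mulrC idealMr // idealMr.
rewrite mul1r !prime_idealrM (negPf (svalP u)) (negPf (svalP t)).
by rewrite (negPf (svalP s)).
Qed.

End Localization.

Arguments loc_max {A} P.

Section HilbertKunz.
Variables (R : realType) (p : nat) (B : comNzRingType) (n : {pred B}).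

(* For a local ring (B, n) of characteristic p. That the Krull dimension and  *)
(* the lengths are finite and that the limit exists is part of the predicate; *)
(* eHK below has the default value 0 when this fails.                         *)
Definition has_eHK (l : R) : Prop :=
  exists (D : nat) (len : nat -> nat),
  [/\ has_krull_dim B D,
      forall e, has_length (quot_mod (frobenius_power n (p ^ e))) (len e) &
      (fun e => (len e)%:R / ((p ^ e) ^ D)%:R : R) @ \oo --> l].

Definition eHK : R := xget 0 [set l | has_eHK l].

End HilbertKunz.

Section Multiplicity.
Variables (R : realType) (d : nat) (A : comNzRingType) (m : {pred A}).

(* Here d is the dimension of A, as in the limit formula d!/n^d l(A/m^n).     *)
Definition has_mult (l : R) : Prop :=
  exists len : nat -> nat,
  (forall n, has_length (quot_mod (ideal_exp m n)) (len n)) /\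
  (fun n => (d`!)%:R / (n ^ d)%:R * (len n)%:R : R) @ \oo --> l.

Definition mult : R := xget 0 [set l | has_mult l].

End Multiplicity.

Section Rees.
Variables (A : comNzRingType) (I : {pred A}).

Lemma ideal_exp0 (x : A) : x \in ideal_exp I 0.
Proof.
rewrite -[x]mulr1; apply: ideal_genMl; apply: mem_ideal_gen.
by exists (fun=> 1) => [[]//|]; rewrite big_ord0.
Qed.

Lemma ideal_expD (i j : nat) (x y : A) :
  x \in ideal_exp I i -> y \in ideal_exp I j -> x * y \in ideal_exp I (i + j).
Proof.
move=> /ideal_genP[n [a [g [Gg ->]]]] /ideal_genP[m [b [h [Gh ->]]]].
rewrite mulr_suml; apply: rpred_sum => s _.
rewrite mulr_sumr; apply: rpred_sum => t _.
rewrite mulrACA; apply: ideal_genMl; apply: mem_ideal_gen.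
have [f fI ->] := Gg s; have [f' fI' ->] := Gh t.
exists (fun r => match split r with inl u => f u | inr u => f' u end).
  by move=> r; case: splitP.
rewrite big_split_ord /=; congr (_ * _); apply: eq_bigr => r _.
  by rewrite (unsplitK (inl r : 'I_i + 'I_j)).
by rewrite (unsplitK (inr r : 'I_i + 'I_j)).
Qed.

(* R(I) = (+)_i I^i t^i inside A[t] *)
Definition rees_pred : {pred {poly A}} :=
  [pred f : {poly A} | `[< forall i, f`_i \in ideal_exp I i >]].

Lemma rees_predP (f : {poly A}) :
  reflect (forall i, f`_i \in ideal_exp I i) (f \in rees_pred).
Proof. exact: asboolP. Qed.

Lemma rees_subring : subring_closed rees_pred.
Proof.
split.
- apply/rees_predP => -[|i]; first exact: ideal_exp0.
  by rewrite coef1 rpred0.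
- move=> f g /rees_predP fI /rees_predP gI; apply/rees_predP => i.
  have [_ Wlin] := submodClosedP (ideal_exp I i).
  by rewrite coefB -mulN1r addrC; apply: Wlin.
- move=> f g /rees_predP fI /rees_predP gI; apply/rees_predP => i.
  rewrite coefM; apply: rpred_sum => -[j /= jle] _.
  by have := ideal_expD (fI j) (gI (i - j)%N); rewrite subnKC // ltnSE.
Qed.

HB.instance Definition _ :=
  GRing.isSubringClosed.Build {poly A} rees_pred rees_subring.

Record rees := Rees { rees_val :> {poly A}; _ : rees_val \in rees_pred }.

HB.instance Definition _ := [isSub for rees_val].
HB.instance Definition _ := [Choice of rees by <:].
HB.instance Definition _ := [SubChoice_isSubComNzRing of rees by <:].

Lemma rees_val_zmod_morphism : zmod_morphism rees_val.
Proof. by []. Qed.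
HB.instance Definition _ :=
  GRing.isZmodMorphism.Build rees {poly A} rees_val rees_val_zmod_morphism.

Lemma rees_val_monoid_morphism : monoid_morphism rees_val.
Proof. by []. Qed.
HB.instance Definition _ :=
  GRing.isMonoidMorphism.Build rees {poly A} rees_val rees_val_monoid_morphism.

(* the ideal (I, It) of R(I) *)
Definition rees_max : {pred rees} :=
  ideal_gen [set f : rees | exists2 a, a \in I &
                              rees_val f = a%:P \/ rees_val f = a *: 'X].

End Rees.

Arguments rees_pred {A} I.
Arguments rees_max {A} I.

Section Veronese.
Variables (k : fieldType) (d c : nat).

(* k[x_1, ..., x_d] *)
Local Notation kx := (mpoly d k).

Definition degree_monomials : set kx :=
  [set f | exists2 u, mdeg u = c & f = mpolyX k u].

Definition veronese_pred : {pred kx} :=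
  [pred f : kx | `[< forall S : subalgClosed kx,
     (forall g, degree_monomials g -> g \in S) -> f \in S >]].

Lemma veronese_predP (f : kx) :
  reflect (forall S : subalgClosed kx,
     (forall g, degree_monomials g -> g \in S) -> f \in S) (f \in veronese_pred).
Proof. exact: asboolP. Qed.

Lemma veronese_subalg : subalg_closed veronese_pred.
Proof.
split.
- by apply/veronese_predP => S _; rewrite rpred1.
- move=> a f g /veronese_predP fV /veronese_predP gV; apply/veronese_predP => S SG.
  by rewrite rpredD ?rpredZ ?fV ?gV.
- move=> f g /veronese_predP fV /veronese_predP gV; apply/veronese_predP => S SG.
  by rewrite rpredM ?fV ?gV.
Qed.

HB.instance Definition _ :=
  GRing.isSubalgClosed.Build k kx veronese_pred veronese_subalg.

Lemma veronese_subring : subring_closed veronese_pred.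
Proof. exact: GRing.subalg_closedBM veronese_subalg. Qed.

HB.instance Definition _ :=
  GRing.isSubringClosed.Build kx veronese_pred veronese_subring.

Record veronese :=
  Veronese { veronese_val :> kx; _ : veronese_val \in veronese_pred }.

HB.instance Definition _ := [isSub for veronese_val].
HB.instance Definition _ := [Choice of veronese by <:].
HB.instance Definition _ := [SubChoice_isSubComNzRing of veronese by <:].

Lemma veronese_val_zmod_morphism : zmod_morphism veronese_val.
Proof. by []. Qed.
HB.instance Definition _ := GRing.isZmodMorphism.Build veronese kx
  veronese_val veronese_val_zmod_morphism.

Lemma veronese_val_monoid_morphism : monoid_morphism veronese_val.
Proof. by []. Qed.
HB.instance Definition _ := GRing.isMonoidMorphism.Build veronese kx
  veronese_val veronese_val_monoid_morphism.

Definition veronese_max : {pred veronese} :=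
  ideal_gen [set f : veronese | degree_monomials (veronese_val f)].


Lemma veronese_ind (Q : veronese -> Prop) :
  (forall a : k, forall f, veronese_val f = a%:A -> Q f) ->
  (forall f, degree_monomials (veronese_val f) -> Q f) ->
  (forall f g, Q f -> Q g -> Q (f + g)) ->
  (forall f g, Q f -> Q g -> Q (f * g)) ->
  forall f, Q f.
Proof.
move=> Qk Qm QD QM [f fV].
pose S : {pred kx} := [pred f : kx | `[< exists2 g, Q g & veronese_val g = f >]].
have SP h : reflect (exists2 g, Q g & veronese_val g = h) (h \in S).
  exact: asboolP.
have cV (a : k) : a%:A \in veronese_pred by rewrite rpredZ ?rpred1.
have Scl : subalg_closed S.
  split.
  - apply/SP; exists 1 => //; apply: (Qk 1); by rewrite scale1r.
  - move=> a u v /SP[g Qg <-] /SP[h Qh <-]; apply/SP.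
    exists (Veronese (cV a) * g + h); last by rewrite /= -scalerAl mul1r.
    by apply: QD => //; apply: QM => //; apply: (Qk a).
  - move=> u v /SP[g Qg <-] /SP[h Qh <-]; apply/SP.
    by exists (g * h) => //; apply: QM.
pose S' : subalgClosed kx := HB.pack_for (subalgClosed kx) S
  (GRing.isSubalgClosed.Build k kx S Scl).
have : f \in S'.
  move/veronese_predP: (fV); apply => g Gg.
  have gV : g \in veronese_pred by apply/veronese_predP => T; exact.
  by apply/SP; exists (Veronese gV) => //; apply: Qm.
by case/SP => g Qg gf; have -> : Veronese fV = g by apply: val_inj; rewrite /= gf.
Qed.

Lemma const_veronese_subproof (a : k) : a%:A \in veronese_pred.
Proof. by rewrite rpredZ ?rpred1. Qed.

Definition const_veronese (a : k) : veronese :=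
  Veronese (const_veronese_subproof a).

Lemma veronese_const_max (f : veronese) :
  exists a : k, f - const_veronese a \in veronese_max.
Proof.
elim/veronese_ind: f => [a f fa | f Gf | f g [a fa] [b gb] | f g [a fa] [b gb]].
- exists a; have -> : f = const_veronese a by apply: val_inj.
  by rewrite subrr rpred0.
- exists 0; have -> : const_veronese 0 = 0 by apply: val_inj; rewrite /= scale0r.
  by rewrite subr0; apply: mem_ideal_gen.
- exists (a + b).
  have -> : const_veronese (a + b) = const_veronese a + const_veronese b.
    by apply: val_inj; rewrite /= scalerDl.
  by rewrite opprD addrACA rpredD.
- exists (a * b).
  have -> : const_veronese (a * b) = const_veronese a * const_veronese b.
    by apply: val_inj; rewrite /= -scalerAl mul1r scalerA.
  have -> : f * g - const_veronese a * const_veronese b =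
    g * (f - const_veronese a) + const_veronese a * (g - const_veronese b).
    by ring.
  by rewrite rpredD // ideal_genMl.
Qed.

Local Notation RA := (rees veronese_max).

Lemma rees_const_subproof (x : veronese) : x%:P \in rees_pred veronese_max.
Proof.
apply/rees_predP => -[|i]; first exact: ideal_exp0.
by rewrite coefC rpred0.
Qed.

Definition rees_const (x : veronese) : RA := Rees (rees_const_subproof x).

Lemma rees_monomial_max (i : nat) (x : veronese) (f : RA) :
  x \in ideal_exp veronese_max i.+1 -> rees_val f = x *: 'X^(i.+1) ->
  f \in rees_max veronese_max.
Proof.
move=> /ideal_genP[n [a [g [Gg xE]]]].
have /choice[h hP] j : exists h : RA, rees_val h = (a j * g j) *: 'X^(i.+1) /\
    h \in rees_max veronese_max.
  have [u um ->] := Gg j.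
  have lP : (a j * \prod_(r < i) u (lift ord0 r)) *: 'X^i \in
      rees_pred veronese_max.
    apply/rees_predP => s; rewrite coefZ coefXn.
    have [->|_] := eqVneq s i; last by rewrite mulr0 rpred0.
    rewrite mulr1; apply: ideal_genMl; apply: mem_ideal_gen.
    by exists (fun r => u (lift ord0 r)).
  have tP : u ord0 *: 'X \in rees_pred veronese_max.
    apply/rees_predP => s; rewrite coefZ coefX.
    have [->|_] := eqVneq s 1%N; last by rewrite mulr0 rpred0.
    rewrite mulr1; apply: mem_ideal_gen.
    by exists (fun _ => u ord0) => [_|]; rewrite ?big_ord1 ?um.
  exists (Rees lP * Rees tP); split.
    rewrite /= -scalerAl -scalerAr scalerA -exprSr big_ord_recl.
    by congr (_ *: _); ring.
  apply: ideal_genMl; apply: mem_ideal_gen.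
  by exists (u ord0) => //; right.
move=> fE; have -> : f = \sum_j h j.
  apply: val_inj; rewrite /= fE raddf_sum /= xE scaler_suml.
  by apply: eq_bigr => j _; rewrite -(hP j).1.
by apply: rpred_sum => j _; exact: (hP j).2.
Qed.

Lemma rees_decomp (f : RA) :
  exists a : k, f - rees_const (const_veronese a) \in rees_max veronese_max.
Proof.
have /rees_predP fP := valP f.
have [a ha] := veronese_const_max (rees_val f)`_0; exists a.
have mP i : (rees_val f)`_i *: 'X^i \in rees_pred veronese_max.
  apply/rees_predP => s; rewrite coefZ coefXn.
  have [->|_] := eqVneq s i; last by rewrite mulr0 rpred0.
  by rewrite mulr1.
have fE : f = rees_const (rees_val f)`_0 +
    \sum_(i < (size (rees_val f)).-1) Rees (mP i.+1).
  apply: val_inj; rewrite /= raddf_sum /= -[LHS]coefK poly_def.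
  have [->|nz] := eqVneq (rees_val f) 0.
    by rewrite size_poly0 !big_ord0 coef0 polyC0 addr0.
  rewrite -[in LHS](@prednK (size (rees_val f))) ?size_poly_gt0 //.
  by rewrite big_ord_recl /= expr0 alg_polyC.
rewrite fE addrAC rpredD //; last first.
  by apply: rpred_sum => i _; apply: (rees_monomial_max (fP i.+1)).
apply: mem_ideal_gen; exists ((rees_val f)`_0 - const_veronese a) => //.
by left; rewrite /= polyCB.
Qed.

Hypothesis c_gt0 : (0 < c)%N.

Lemma veronese_max_coeff0 (f : veronese) :
  f \in veronese_max -> mcoeff mnm0 (veronese_val f) = 0.
Proof.
move=> /ideal_genP[n [a [g [Gg ->]]]].
rewrite raddf_sum /= raddf_sum /= big1 // => i _.
have [u uc gu] := Gg i.
rewrite rmorphM /= gu mcoeffX; case: eqP => [u0|]; last by rewrite mulr0.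
by move: c_gt0; rewrite -uc u0 mdeg0.
Qed.

Lemma rees_max_coeff0 (f : RA) : f \in rees_max veronese_max ->
  mcoeff mnm0 (veronese_val (rees_val f)`_0) = 0.
Proof.
move=> /ideal_genP[n [a [g [Gg ->]]]].
rewrite raddf_sum /= coef_sum raddf_sum /= raddf_sum /= big1 // => i _.
rewrite coef0M rmorphM /=.
have [u um [->|->]] := Gg i.
  by rewrite coefC /= (veronese_max_coeff0 um) mulr0.
by rewrite coefZ coefX mulr0 raddf0 mulr0.
Qed.

Lemma rees_max_constE (a : k) :
  (rees_const (const_veronese a) \in rees_max veronese_max) = (a == 0).
Proof.
apply/idP/eqP => [/rees_max_coeff0 | ->].
  rewrite /= coefC /= linearZ /= mcoeff1 eqxx => <-; by rewrite mulr1.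
have -> : rees_const (const_veronese 0) = 0; last exact: rpred0.
apply: val_inj; rewrite /= -[RHS]polyC0; congr polyC; apply: val_inj.
by rewrite /= scale0r.
Qed.

End Veronese.

Arguments veronese_max k d c : clear implicits.

Section ReesPrime.
Variables (k : fieldType) (d c : nat) (c_gt0 : (0 < c)%N).

(* The ideal M = (m, mt) of R(m), as a prime ideal; the positivity of c is    *)
(* what makes it proper.                                                      *)
Definition veronese_rees_max : {pred rees (veronese_max k d c)} :=
  rees_max (veronese_max k d c).

Lemma veronese_rees_max_idealr : idealr_closed veronese_rees_max.
Proof.
split; first exact: rpred0.
  have -> : 1 = rees_const (const_veronese d c (1 : k)).
    apply: val_inj; rewrite /= -[LHS]polyC1; congr polyC; apply: val_inj.
    by rewrite /= scale1r.
  by rewrite /veronese_rees_max rees_max_constE // oner_eq0.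
move=> a f g fM gM; rewrite /veronese_rees_max rpredD //.
exact: ideal_genMl.
Qed.

Lemma veronese_rees_max_prime : prime_idealr_closed veronese_rees_max.
Proof.
move=> f g; rewrite /veronese_rees_max => fgM.
have [a fa] := rees_decomp f; have [b gb] := rees_decomp g.
set C := fun a : k => rees_const (const_veronese d c a).
have CM (x y : k) : C (x * y) = C x * C y.
  apply: val_inj; rewrite /= -polyCM; congr polyC; apply: val_inj.
  by rewrite /= -scalerAl mul1r scalerA.
have memE (h : rees (veronese_max k d c)) (x : k) :
    h - C x \in rees_max (veronese_max k d c) ->
    (h \in rees_max (veronese_max k d c)) = (x == 0).
  move=> hx; rewrite -(rees_max_constE d c_gt0); apply/idP/idP => H.
    have -> : rees_const (const_veronese d c x) = h + (-1) * (h - C x).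
      by rewrite mulN1r opprB addrC subrK.
    by rewrite rpredD // ideal_genMl.
  by rewrite -[h](subrK (C x)) rpredD.
rewrite (memE f a fa) (memE g b gb) -mulf_eq0 -(rees_max_constE d c_gt0).
rewrite -/(C _) CM.
have -> : C a * C b = f * g + ((- g) * (f - C a) + (- C a) * (g - C b)) by ring.
by rewrite rpredD // rpredD // ideal_genMl.
Qed.

Definition veronese_rees_prime : prime_idealr (rees (veronese_max k d c)) :=
  HB.pack_for (prime_idealr (rees (veronese_max k d c))) veronese_rees_max
    (isIdealr.Build _ veronese_rees_max veronese_rees_max_idealr)
    (isPrimeIdealrClosed.Build _ veronese_rees_max veronese_rees_max_prime).

End ReesPrime.

Arguments veronese_rees_prime k d [c] c_gt0.

Section VeroneseInvariants.
Variables (R : realType) (k : fieldType) (d c : nat).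

(* e_HK(R(m)) = e_HK(R(m)_M), where p is the characteristic of k *)
Definition has_eHK_rees (p : nat) (c_gt0 : (0 < c)%N) : R -> Prop :=
  has_eHK p (loc_max (veronese_rees_prime k d c_gt0)).

Definition eHK_rees (p : nat) (c_gt0 : (0 < c)%N) : R :=
  eHK R p (loc_max (veronese_rees_prime k d c_gt0)).

(* e(A), the multiplicity of A = k[x_1, ..., x_d]^(c) *)
Definition has_mult_veronese : R -> Prop := has_mult d (veronese_max k d c).

Definition mult_veronese : R := mult R d (veronese_max k d c).

End VeroneseInvariants.

Arguments has_eHK_rees {R} k d [c] p c_gt0 l.
Arguments eHK_rees R k d [c] p c_gt0.
Arguments has_mult_veronese {R} k d c l.

(* Main.v *)
(* R(m) is the semigroup algebra of the cone {(u, j) : c | |u|, c j <= |u|}, and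
   the quotient of its localization at M by the q-th powers of M has as basis the
   monomials x^u t^j of the cone that are not divisible by a q-th power of a
   generator; ordered by decreasing degree they give a composition series. With
   u = q a + r, the monomial is standard iff |a| < c, or j < q and c(j + q) > |u|.
   So the length is a sum over a in [0, 2c)^d of sums over r in [0, q)^d of a
   function of |u| restricted to c | |u|. That function is monotone on every cell
   a, so dropping the congruence costs a factor 1/c up to O(q^d), and the sum over
   r, divided by q^(d+1), is monotone along q = p^e, hence convergent. When
   d <= c + 1 everything is explicit:
     e_HK = c^(-2) ((2c)^(d+1)/(d+1)! + d C(c+d-1, d) - 2 C(c+d, d+1)),
   and d C(c+d-1, d) <= 2 C(c+d, d+1) is exactly the condition c >= d(d-1)/2.
   The dimension of the localization is d + 1: a chain of primes of length n yields
   N^n linearly independent elements of degree O(N), in a space of dimension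
   O(N^(d+1)), while the faces of the cone give a chain of length d + 1. *)
From HB Require Import structures.
Require Import Defs.
From mathcomp Require Import all_boot all_order all_algebra.
From mathcomp Require Import generic_quotient ring_quotient.
From mathcomp Require Import ring zify.
From mathcomp Require mpoly.
From mathcomp Require Import boolp classical_sets reals topology normedtype.
From mathcomp Require Import sequences.
Import -(notations) mpoly.
Import Order.TTheory GRing.Theory Num.Theory numFieldNormedType.Exports.

Set Implicit Arguments.
Unset Strict Implicit.
Unset Printing Implicit Defensive.

Local Open Scope classical_set_scope.
Local Open Scope ring_scope.
Local Open Scope quotient_scope.

(** Monotonicity in [e] is one-sided rounding: refining a cell by the factor [p] replaces [m] by
    [p m + r] with [r >= 0], which can only raise the weight [m] and only lower the weight
    [2 c q - m]. The congruence is dropped by Abel summation along one coordinate. The error is at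
    most a boundary term plus the total variation of a monotone weight, hence O(q) on each line and
    O(q^d) altogether. The threshold [d <= c + 1] comes from the largest [|u|] in a cell with
    [|a| < c]: it is at most [q (c - 1 + d)], and this must not exceed [2 c q]. Writing
    [m = (2 c q - m) - 2 (c q - m)] on those cells then leaves a sum over the whole box and
    corrections that depend on [|a|] only, all of them binomial coefficients. After division by
    [c^(d-1)] the first term of the closed formula is constant, the second is O(1/c) and the third
    tends to [2/(d+1)!], which gives the limit. *)

(** * Lengths of modules, of quotients and of localizations *)

Section CompositionSeries.
Variables (B : pzRingType) (M : lmodType B) (n : nat) (J : nat -> submodClosed M).
Hypotheses (J0 : forall x, x \in J 0 -> x = 0) (Jn : forall x, x \in J n).
Hypothesis Jstrict : forall i, (i < n)%N ->
  {subset J i <= J i.+1} /\ ~ {subset J i.+1 <= J i}.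
Hypothesis Jsimple : forall i, (i < n)%N -> forall x y,
  x \in J i.+1 -> y \in J i.+1 -> y \notin J i -> exists r, x - r *: y \in J i.

(** Indices of the factors [J i.+1 / J i] in which [N] has a nonzero image. Counting them bounds
    every chain by [n], in place of the Jordan-Hölder theorem. *)
Definition jumps (N : submodClosed M) : {set 'I_n} :=
  [set i : 'I_n | `[< exists2 x, x \in N & (x \in J i.+1) && (x \notin J i) >]].

(** If [N'] had no new jump, an element of [N'] could be pushed down the series: at each jump
    [Jsimple] subtracts a multiple of an element of [N], until [J 0 = 0] is reached, so the element
    was in [N] already. *)
Lemma jumps_proper (N N' : submodClosed M) :
  {subset N <= N'} -> ~ {subset N' <= N} -> (jumps N \proper jumps N')%SET.
Proof.
move=> NN' N'N; rewrite properE; apply/andP; split.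
  apply/fintype.subsetP => i; rewrite !inE => -[x xN xJ].
  by exists x => //; exact: NN'.
apply/negP => /fintype.subsetP jN; apply: N'N.
have H i : (i <= n)%N -> forall x, x \in N' -> x \in J i -> x \in N.
  elim: i => [_ x _ /J0 ->|i IH lin x xN' xJ]; first exact: rpred0.
  have [xJi|xJi] := boolP (x \in J i); first exact: IH (ltnW lin) _ xN' xJi.
  have : Ordinal lin \in jumps N'.
    by rewrite !inE; exists x => //; rewrite xJ xJi.
  move=> /jN; rewrite !inE => -[y yN /andP[/= yJ yJi]].
  have [r xry] := Jsimple lin xJ yJ yJi.
  rewrite -[x](subrK (r *: y)); apply: rpredD; last exact: rpredZ.
  apply: (IH (ltnW lin)) xry.
  by rewrite -scaleNr rpredD // rpredZ // NN'.
by move=> x xN'; apply: (H n) => //.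
Qed.

Lemma composition_series_length : has_length M n.
Proof.
split; first by exists J.
move=> m [N Nstrict].
suff H i : (i <= m)%N -> (i <= #|jumps (N i)|)%N.
  by apply: leq_trans (H m (leqnn _)) _; rewrite -[leqRHS]card_ord max_card.
elim: i => // i IH im; have [NN' N'N] := Nstrict _ im.
apply: leq_ltn_trans (IH (ltnW im)) _.
by apply: proper_card; exact: jumps_proper.
Qed.

End CompositionSeries.

Section QuotientLength.
Variables (B : pzRingType) (V : lmodType B) (W : submodClosed V).
Variables (n : nat) (J : nat -> submodClosed V).
Hypotheses (J0 : J 0 =i W) (Jn : forall x, x \in J n).
Hypothesis Jstrict : forall i, (i < n)%N ->
  {subset J i <= J i.+1} /\ ~ {subset J i.+1 <= J i}.
Hypothesis Jsimple : forall i, (i < n)%N -> forall x y,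
  x \in J i.+1 -> y \in J i.+1 -> y \notin J i -> exists r, x - r *: y \in J i.

Lemma pi_quot0 : \pi_(quot_mod W) 0 = 0.
Proof. by apply: (addrI (\pi_(quot_mod W) 0)); rewrite -pi_quotD !addr0. Qed.

Definition quot_submod_pred (U : submodClosed V) : {pred quot_mod W} :=
  [pred x | `[< exists2 v, v \in U & x = \pi_(quot_mod W) v >]].

Lemma quot_submod_closed (U : submodClosed V) :
  submod_closed (quot_submod_pred U).
Proof.
split; first by apply/asboolP; exists 0; [exact: rpred0|rewrite pi_quot0].
move=> b x y /asboolP[u uU ->] /asboolP[v vU ->]; apply/asboolP.
exists (b *: u + v); first by rewrite rpredD // rpredZ.
rewrite pi_quotD; congr (_ + _); exact: pi_quot_scale.
Qed.

Definition quot_submod (U : submodClosed V) : submodClosed (quot_mod W) :=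
  HB.pack_for (submodClosed (quot_mod W)) (quot_submod_pred U)
    (GRing.isSubmodClosed.Build B (quot_mod W) (quot_submod_pred U)
       (quot_submod_closed U)).

Lemma mem_quot_submod (U : submodClosed V) (x : V) : {subset W <= U} ->
  (\pi_(quot_mod W) x \in quot_submod U) = (x \in U).
Proof.
move=> WU; apply/idP/idP => [/asboolP[v vU /eqP]|xU].
  by rewrite quot_modE => /WU xv; rewrite -[x](subrK v) rpredD.
by apply/asboolP; exists x.
Qed.

Lemma quot_mod_length : has_length (quot_mod W) n.
Proof.
have WJ i : (i <= n)%N -> {subset W <= J i}.
  elim: i => [_ x|i IH lin x xW]; first by rewrite J0.
  by apply: (Jstrict lin).1; apply: IH => //; exact: ltnW.
apply: (@composition_series_length _ _ _ (fun i => quot_submod (J i))).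
- elim/quot_modW => x; rewrite mem_quot_submod ?J0 //; last exact: WJ.
  move=> xW; rewrite -pi_quot0.
  by apply/eqP; rewrite quot_modE subr0.
- by elim/quot_modW => x; rewrite mem_quot_submod //; exact: WJ.
- move=> i lin; have [s ns] := Jstrict lin; split.
    by elim/quot_modW=> x; rewrite !mem_quot_submod; [exact: s|exact: WJ|exact: WJ (ltnW _)].
  move=> H; apply: ns => x xJ; have := H (\pi_(quot_mod W) x).
  by rewrite !mem_quot_submod; [apply|exact: WJ (ltnW _)|exact: WJ].
- move=> i lin; elim/quot_modW => x; elim/quot_modW => y.
  have Wi := WJ _ (ltnW lin).
  rewrite !mem_quot_submod //; [|exact: WJ|exact: WJ].
  move=> xJ yJ yJi; have [r xry] := Jsimple lin xJ yJ yJi; exists r.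
  have -> : \pi_(quot_mod W) x - r *: \pi_(quot_mod W) y = \pi_(quot_mod W) (x - r *: y).
    rewrite -!scaleN1r pi_quotD; congr (_ + _); rewrite -pi_quot_scale.
    by congr (_ *: _); rewrite -pi_quot_scale.
  by rewrite mem_quot_submod.
Qed.

End QuotientLength.

Section LocalizedIdeals.
Variables (A : comNzRingType) (P : prime_idealr A).
Implicit Types W : submodClosed A^o.

Lemma submod_idealD W (x y : A) : x \in W -> y \in W -> x + y \in W.
Proof. exact: (@rpredD A^o W x y). Qed.

Lemma submod_idealMl W (a x : A) : x \in W -> a * x \in W.
Proof. exact: (@rpredZ A A^o W a x). Qed.

(** The condition under which an ideal can be read off its extension to [A_P]: whether a fraction
    belongs to the extension then depends on its numerator alone. *)
Definition saturated W : Prop := forall u a, u \notin P -> u * a \in W -> a \in W.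

Definition loc_ideal_pred W : {pred (localization P)^o} :=
  [pred x | `[< exists (a : A) (s : denom P), a \in W /\ x = mk_frac a s >]].

Lemma loc_ideal_closed W : submod_closed (loc_ideal_pred W).
Proof.
split; first by apply/asboolP; exists 0, (denom1 P); split; [exact: rpred0|reflexivity].
move=> b x y /asboolP[a [s [aW ->]]] /asboolP[a' [s' [aW' ->]]].
elim/mk_fracW: b => b t; apply/asboolP.
exists (b * a * sval s' + a' * sval (denomM t s)), (denomM (denomM t s) s').
split; last first.
  transitivity (loc_add (loc_mul (mk_frac b t) (mk_frac a s)) (mk_frac a' s')) => //.
  by rewrite loc_mulE loc_addE.
apply: submod_idealD; last by rewrite mulrC submod_idealMl.
by rewrite mulrC; do 2!apply: submod_idealMl.

Qed.

Definition loc_ideal W : submodClosed (localization P)^o :=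
  HB.pack_for (submodClosed (localization P)^o) (loc_ideal_pred W)
    (GRing.isSubmodClosed.Build _ (localization P)^o (loc_ideal_pred W)
       (loc_ideal_closed W)).

Lemma mem_loc_ideal W a (s : denom P) :
  saturated W -> (mk_frac a s \in loc_ideal W) = (a \in W).
Proof.
move=> Wsat; apply/idP/idP => [/asboolP[b [t [bW /eqP/mk_frac_eqP[u e]]]]|aW].
  apply: (Wsat (sval u * sval t)).
    by rewrite prime_idealrM negb_or (svalP u) (svalP t).
  have -> : sval u * sval t * a = (sval u * sval s) * b.
    by rewrite -mulrA [sval t * a]mulrC e; ring.
  exact: submod_idealMl.
by apply/asboolP; exists a, s.
Qed.

(** Frobenius powers commute with localization, since a [q]-th power of a fraction is a fraction of
    [q]-th powers and denominators are units. *)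
Lemma mem_frobenius_loc_max (q : nat) a (s : denom P) :
  saturated (frobenius_power P q) ->
  (mk_frac a s \in frobenius_power (loc_max P) q) = (a \in frobenius_power P q).
Proof.
move=> sat; apply/idP/idP => [|aF].
  rewrite -(mem_loc_ideal a s sat).
  move=> /ideal_genP[n [b [g [Gg ->]]]]; apply: rpred_sum => i _.
  apply: (@rpredZ _ (localization P)^o (loc_ideal (frobenius_power P q))).
  have [x /= xM <-] := Gg i; elim/mk_fracW: x xM => h t; rewrite mem_loc_max => hP.
  have -> : mk_frac h t ^+ q = mk_frac (h ^+ q) (iter q (denomM t) (denom1 P)).
    elim: q {i b g Gg sat} => [|q IH]; first by rewrite !expr0.
    by rewrite !exprS IH [LHS]loc_mulE.
  by rewrite mem_loc_ideal //; apply: mem_ideal_gen; exists h.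
move: aF => /ideal_genP[n [b [g [Gg ->]]]].
have mkM x y t : mk_frac (x * y) t = mk_frac x t * mk_frac y (denom1 P).
  rewrite [RHS]loc_mulE; apply: (@mk_frac_eq _ _ _ _ _ _ (denom1 P)) => /=; ring.
have -> : mk_frac (\sum_i b i * g i) s = \sum_i mk_frac (b i) s * mk_frac (g i) (denom1 P).
  elim/big_rec2: _ => [|i y x _ <-].
    by apply: (@mk_frac_eq _ _ _ _ _ _ (denom1 P)) => /=; ring.
  rewrite -mkM [RHS]loc_addE; apply: (@mk_frac_eq _ _ _ _ _ _ (denom1 P)) => /=; ring.
apply: rpred_sum => i _; apply: ideal_genMl.
have [x /= xP <-] := Gg i; apply: mem_ideal_gen; exists (mk_frac x (denom1 P)).
  by rewrite /= mem_loc_max.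
elim: q {i b g Gg sat} => [|q IH]; first by rewrite !expr0.
by rewrite !exprS IH mkM.
Qed.

End LocalizedIdeals.

Section LocalizationLength.
Variables (A : comNzRingType) (P : prime_idealr A).
Hypothesis P_max : forall u, u \notin P -> exists v, 1 - v * u \in P.
Variables (n : nat) (J : nat -> submodClosed A^o).
Hypothesis Jn : forall x, x \in J n.
Hypothesis Jstrict : forall i, (i < n)%N ->
  {subset J i <= J i.+1} /\ ~ {subset J i.+1 <= J i}.
Hypothesis Jsimple : forall i, (i < n)%N -> forall x y : A,
  x \in J i.+1 -> y \in J i.+1 -> y \notin J i -> exists r, x - r * y \in J i.
Hypothesis Jkill : forall i, (i < n)%N -> forall x y : A,
  x \in P -> y \in J i.+1 -> x * y \in J i.

(** Choose [v] with [1 - v u] in [P] and write [a = (1 - v u) a + v (u a)]. The first summand drops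
    one step because [P] kills the factors, and the second is in [J i] by assumption, so [a]
    descends step by step from [J n] to [J i]. *)
Lemma series_saturated i : (i <= n)%N -> saturated P (J i).
Proof.
move=> lin u a uP uaJ.
have [v vP] := P_max uP.
have mono m : (i + m <= n)%N -> {subset J i <= J (i + m)}.
  elim: m => [|m IH]; first by rewrite addn0 => _ x.
  rewrite addnS => lin' x xJ; apply: (Jstrict lin').1.
  by apply: IH => //; exact: ltnW.
suff H m : (i + m <= n)%N -> a \in J (i + m) -> a \in J i.
  by apply: (H (n - i)%N); rewrite subnKC.
elim: m => [|m IH]; first by rewrite addn0.
rewrite addnS => lin' aJ; apply: IH; first exact: ltnW.
have -> : a = (1 - v * u) * a + v * (u * a) by ring.
apply: submod_idealD; first by apply: Jkill.
apply: submod_idealMl.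
by apply: mono => //; exact: ltnW.
Qed.

Variable W : submodClosed (localization P)^o.
Hypothesis WE : forall a s, (mk_frac a s \in W) = (a \in J 0).

Lemma localization_length : has_length (quot_mod W) n.
Proof.
have mem i a s : (i <= n)%N -> (mk_frac a s \in loc_ideal P (J i)) = (a \in J i).
  by move=> lin; apply: mem_loc_ideal; exact: series_saturated.
apply: (@quot_mod_length _ _ W n (fun i => loc_ideal P (J i))).
- by elim/mk_fracW => a s; rewrite mem // WE.
- by elim/mk_fracW => a s; rewrite mem.
- move=> i lin; have [sJ nsJ] := Jstrict lin; split.
    by elim/mk_fracW=> a s; rewrite !mem //; [exact: sJ|exact: ltnW].
  move=> H; apply: nsJ => a aJ; have := H (@mk_frac A P a (denom1 P)).
  by rewrite !mem //; [apply|exact: ltnW].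
- move=> i lin; elim/mk_fracW => a s; elim/mk_fracW => b t.
  rewrite !mem //; last exact: ltnW.
  move=> aJ bJ bJi; have [r rJ] := Jsimple lin aJ bJ bJi.
  exists (mk_frac (r * sval t) s).
  have -> : mk_frac a s - mk_frac (r * sval t) s *: (mk_frac b t : (localization P)^o) =
     mk_frac (a - r * b) s.
    transitivity (loc_add (mk_frac a s)
      (loc_opp (loc_mul (mk_frac (r * sval t) s) (mk_frac b t)))) => //.
    rewrite loc_mulE loc_oppE loc_addE.
    by apply: (@mk_frac_eq _ _ _ _ _ _ (denom1 P)) => /=; ring.
  by rewrite mem //; exact: ltnW.
Qed.

End LocalizationLength.

(** * Lengths from a finite list of standard monomials *)

Section MonomialCoordinates.
Variables (k : fieldType) (T : comNzRingType) (P : {pred T}).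
Variables (I : eqType) (cf : T -> I -> k) (C : {rmorphism k -> T}) (deg : I -> nat) (L : seq I).
Hypothesis cfD : forall f g w, cf (f + g) w = cf f w + cf g w.
Hypothesis cfC : forall a f w, cf (C a * f) w = a * cf f w.
Hypothesis P_C : forall f, exists a, f - C a \in P.
Hypothesis L_uniq : uniq L.
(** Standard monomials are closed under division, and a factor from [P] has positive degree. This is
    what makes [P] kill the factors of the series built below. *)
Hypothesis cf_deg : forall f g w, f \in P -> w \in L -> cf (f * g) w != 0 ->
  exists2 w', w' \in L & (deg w' < deg w)%N && (cf g w' != 0).
Hypothesis cf_mon : forall w, w \in L ->
  exists X, forall w', w' \in L -> cf X w' = (w' == w)%:R.

(** The term [J i] consists of the elements with no coefficient on [drop i L'], so it admits the [i]
    standard monomials of largest degree. Multiplication by [P] moves coefficients towards the front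
    of this list. *)
Let L' := sort (fun v w => (deg w <= deg v)%N) L.

Let memL' w : (w \in L') = (w \in L).
Proof. exact: mem_sort. Qed.

Let szL' : size L' = size L.
Proof. exact: size_sort. Qed.

Definition vanishing_pred (s : seq I) : {pred T^o} :=
  [pred f : T | `[< forall w, w \in s -> cf f w = 0 >]].

Let cf0 w : cf 0 w = 0.
Proof. by apply: (addrI (cf 0 w)); rewrite -cfD !addr0. Qed.

Let low_tail w w' i : w \in drop i L' -> w' \in L ->
  (deg w' < deg w)%N -> w' \in drop i.+1 L'.
Proof.
move=> wi; rewrite -memL' => w'L lt.
have srt : sorted (fun v w => (deg w <= deg v)%N) L'.
  by apply: sort_sorted => x y; rewrite leq_total.
pose l := index w' L'; have lL : (l < size L')%N by rewrite index_mem.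
have /nthP-/(_ w)[j] := wi; rewrite size_drop => jlt; rewrite nth_drop => wE.
have jL : (i + j < size L')%N by rewrite -ltn_subRL.
have lj : (i + j < l)%N.
  rewrite ltnNge; apply/negP => le.
  move: lt; rewrite ltnNge => /negP; apply.
  rewrite -[in leqLHS]wE -(nth_index w w'L) -/l.
  have tr : transitive (fun v w => (deg w <= deg v)%N).
    by move=> x y z /= a b; exact: leq_trans b a.
  have rf : reflexive (fun v w => (deg w <= deg v)%N) by move=> x /=.
  by apply: (sorted_leq_nth tr rf w srt l (i + j)%N).
have il : (i.+1 <= l)%N by apply: leq_ltn_trans lj; exact: leq_addr.
rewrite -(nth_index w w'L) -/l -(subnKC il) -nth_drop.
by apply: mem_nth; rewrite size_drop ltn_sub2r //; exact: leq_trans lL.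
Qed.

Let vanP i f : reflect (forall w, w \in drop i L' -> cf f w = 0)
  (f \in vanishing_pred (drop i L')).
Proof. exact: asboolP. Qed.

Let vanishing_mulP i f g : f \in P -> g \in vanishing_pred (drop i.+1 L') ->
  f * g \in vanishing_pred (drop i L').
Proof.
move=> fP /vanP gv; apply/vanP => w wi; apply/eqP; apply/negPn/negP => nz.
have wL : w \in L by rewrite -memL'; exact: mem_drop wi.
have [w' w'L /andP[lt]] := cf_deg fP wL nz.
by rewrite gv ?eqxx //; exact: low_tail lt.
Qed.

Let vanishing_sub i f : f \in vanishing_pred (drop i L') ->
  f \in vanishing_pred (drop i.+1 L').
Proof.
move=> /vanP fv; apply/vanP => w wi; apply: fv.
by move: wi; rewrite -add1n -drop_drop; exact: mem_drop.
Qed.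

Let vanishing_closed i : submod_closed (vanishing_pred (drop i L')).
Proof.
split=> [|b f g fv gv]; first by apply/vanP => w _; rewrite cf0.
have [a ba] := P_C b; apply/vanP => w wi.
(* Only scalars act coefficientwise, so a general [b] is split into a scalar and an element of [P];
   the latter sends [f] even one step deeper. *)
have -> : b *: f + g = (b - C a) * f + (C a * f + g).
  transitivity (b * f + g) => //; ring.
rewrite !cfD cfC (vanP _ _ fv) // (vanP _ _ gv) // mulr0 addr0.
by rewrite addr0 (vanP _ _ (vanishing_mulP ba (vanishing_sub fv))).
Qed.

Let J i : submodClosed T^o :=
  HB.pack_for (submodClosed T^o) (vanishing_pred (drop i L'))
    (GRing.isSubmodClosed.Build _ T^o (vanishing_pred (drop i L'))
       (vanishing_closed i)).

Let J0E f : (f \in J 0) = `[< forall w, w \in L -> cf f w = 0 >].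
Proof.
apply/idP/asboolP => [/vanP fv w wL|fv].
  by apply: fv; rewrite drop0 memL'.
by apply/vanP => w; rewrite drop0 memL'; exact: fv.
Qed.

Let Jn f : f \in J (size L).
Proof. by apply/vanP => w; rewrite -szL' drop_size. Qed.

Let Jcons i : (i < size L)%N -> exists w, [/\ w \in L,
  drop i L' = w :: drop i.+1 L' & w \notin drop i.+1 L'].
Proof.
move=> iL; have : L' != [::] by rewrite -size_eq0 szL' -lt0n; exact: leq_trans iL.
case E : L' => [//|w0 s] _; rewrite -E; exists (nth w0 L' i).
have iL' : (i < size L')%N by rewrite szL'.
split; [by rewrite -memL' mem_nth | exact: drop_nth |].
have : uniq (drop i L') by apply: drop_uniq; rewrite sort_uniq.
by rewrite (drop_nth w0 iL') => /andP[].
Qed.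

Let Jstrict i : (i < size L)%N ->
  {subset J i <= J i.+1} /\ ~ {subset J i.+1 <= J i}.
Proof.
move=> iL; split=> [f|H]; first exact: vanishing_sub.
have [w [wL dE wN]] := Jcons iL.
have [X XE] := cf_mon wL.
have /H/vanP/(_ w) : X \in J i.+1.
  apply/vanP => w' w'd; rewrite XE; last by rewrite -memL'; exact: mem_drop w'd.
  by case: eqP w'd wN => // -> ->.
by rewrite dE mem_head XE // eqxx => /(_ isT)/eqP; rewrite oner_eq0.
Qed.

Let Jsimple i : (i < size L)%N -> forall f g : T,
  f \in J i.+1 -> g \in J i.+1 -> g \notin J i -> exists r, f - r * g \in J i.
Proof.
move=> iL f g /vanP fv /vanP gv gN.
have [w [wL dE wN]] := Jcons iL.
have gw : cf g w != 0.
  apply: contra gN => /eqP gw0; apply/vanP => w'.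
  by rewrite dE inE => /orP[/eqP ->|/gv].
(* [J i] and [J i.+1] differ in the single coordinate [w], and this multiple of [g] cancels it. *)
exists (C (cf f w / cf g w)); apply/vanP => w' w'd.
have cfN h v : cf (- h) v = - cf h v.
  by apply: (addrI (cf h v)); rewrite -cfD !subrr cf0.
rewrite cfD cfN cfC; move: w'd; rewrite dE inE => /orP[/eqP ->|w'd].
  by rewrite divfK // subrr.
by rewrite (fv w') // (gv w') // mulr0 subr0.
Qed.

Lemma monomial_quot_length (W : submodClosed T^o) :
  (forall f, f \in W <-> forall w, w \in L -> cf f w = 0) ->
  has_length (quot_mod W) (size L).
Proof.
move=> WE; apply: (@quot_mod_length _ _ _ _ J) => //.
by move=> f; rewrite J0E; apply/asboolP/idP => /WE.
Qed.

(** The description of [W] may assume that [K] is saturated, as [mem_frobenius_loc_max] does; the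
    saturation comes from the series itself, whose bottom term is [K]. *)
Lemma monomial_localization_length (Q : prime_idealr T) (K : submodClosed T^o)
    (W : submodClosed (localization Q)^o) :
  (forall f, (f \in Q) = (f \in P)) ->
  (forall f, f \in K <-> forall w, w \in L -> cf f w = 0) ->
  (saturated Q K -> forall f s, (mk_frac f s \in W) = (f \in K)) ->
  has_length (quot_mod W) (size L).
Proof.
move=> QP KE WE.
have Qmax u : u \notin Q -> exists v, 1 - v * u \in Q.
  have [a ua] := P_C u => uQ.
  have a0 : a != 0.
    by apply: contraNneq uQ => a0; move: ua; rewrite QP a0 rmorph0 subr0.
  exists (C a^-1).
  have -> : 1 - C a^-1 * u = - C a^-1 * (u - C a).
    by rewrite mulrBr !mulNr opprK -rmorphM mulVf // rmorph1 addrC.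
  by rewrite idealMr ?QP.
have Jkill i : (i < size L)%N -> forall x y : T, x \in Q -> y \in J i.+1 -> x * y \in J i.
  by move=> _ x y; rewrite QP => xP; exact: vanishing_mulP.
have J0K f : (f \in J 0) = (f \in K).
  by rewrite J0E; apply/asboolP/idP => /KE.
apply: (@localization_length _ _ Qmax _ J) => // f s; rewrite WE // => u a uQ.
by rewrite -!J0K; exact: (@series_saturated _ _ Qmax _ J).
Qed.

End MonomialCoordinates.

(** * Upper bound for chains of primes by linear independence *)

Section LinearlyFreeModulo.
Variables (k : fieldType) (T : comNzRingType) (C : {rmorphism k -> T}).
Implicit Types (p : {pred T}) (s : seq T).

Definition free_mod p s : Prop := forall c : nat -> k,
  \sum_(i < size s) C (c i) * s`_i \in p -> forall i, (i < size s)%N -> c i = 0.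

(* The part of a relation without [x] lies in [p1], so it is trivial; then [x]
   cancels modulo the prime [p0]. *)
Lemma free_mod_cons p0 p1 x s t :
  {in p0 &, forall f g, f - g \in p0} -> {in p1 &, forall f g, f - g \in p1} ->
  (forall f g, g \in p1 -> f * g \in p1) ->
  (forall f g, f * g \in p0 -> f \in p0 \/ g \in p0) -> 0 \in p0 ->
  {subset p0 <= p1} -> x \in p1 -> x \notin p0 ->
  free_mod p1 s -> free_mod p0 t -> free_mod p0 (s ++ [seq x * y | y <- t]).
Proof.
move=> p0B p1B p1M p0P p00 p01 xp1 xp0 sf tf c.
rewrite size_cat size_map big_split_ord /=.
have -> : \sum_(i < size t) C (c (size s + i)%N) * (s ++ [seq x * y | y <- t])`_(size s + i)
        = x * \sum_(i < size t) C (c (size s + i)%N) * t`_i.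
  rewrite mulr_sumr; apply: eq_bigr => i _.
  rewrite nth_cat ltnNge leq_addr /= addKn (nth_map 0) //; ring.
have -> : \sum_(i < size s) C (c i) * (s ++ [seq x * y | y <- t])`_i =
    \sum_(i < size s) C (c i) * s`_i.
  by apply: eq_bigr => i _; rewrite nth_cat ltn_ord.
move=> H.
have c0 i : (i < size s)%N -> c i = 0.
  apply: sf; rewrite -[X in X \in p1](addrK (x * \sum_(i < size t) C (c (size s + i)%N) * t`_i)).
  by apply: p1B; [exact: p01|rewrite mulrC; exact: p1M].
move: H; rewrite big1 ?add0r => [|i _]; last by rewrite c0 // rmorph0 mul0r.
move=> /p0P[xp|cp i lt]; first by rewrite xp in xp0.
have [/c0 //|le] := ltnP i (size s).
rewrite -(subnKC le); apply: (tf (fun i => c (size s + i)%N) cp).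
by rewrite ltn_subLR.
Qed.

(** The family consists of the [N] blocks [s], [x s], ..., [x^(N-1) s]. One strict inclusion of
    primes thus multiplies the size of a free family by an arbitrary [N]. *)
Lemma free_mod_pows p0 p1 x s N :
  {in p0 &, forall f g, f - g \in p0} -> {in p1 &, forall f g, f - g \in p1} ->
  (forall f g, g \in p1 -> f * g \in p1) ->
  (forall f g, f * g \in p0 -> f \in p0 \/ g \in p0) -> 0 \in p0 ->
  {subset p0 <= p1} -> x \in p1 -> x \notin p0 ->
  free_mod p1 s ->
  free_mod p0 (iter N (fun t => s ++ [seq x * y | y <- t]) [::]).
Proof.
move=> *; elim: N => [|N IH]; first by move=> c _ [].
exact: (@free_mod_cons _ p1).
Qed.

End LinearlyFreeModulo.

Section KrullUpperBound.
Variables (k : fieldType) (T : comNzRingType) (C : {rmorphism k -> T}).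
Variables (I : eqType) (cf : T -> I -> k) (box : nat -> seq I) (D : nat).
Hypothesis cfD : forall f g w, cf (f + g) w = cf f w + cf g w.
Hypothesis cfC : forall a f w, cf (C a * f) w = a * cf f w.
Hypothesis cf_inj : forall f, (forall w, cf f w = 0) -> f = 0.
Hypothesis box_size : forall m, size (box m) = (m.+1 ^ D)%N.

Definition bounded m : {pred T} :=
  [pred f | `[< forall w, cf f w != 0 -> w \in box m >]].

Hypothesis bounded_ex : forall f, exists m, f \in bounded m.
Hypothesis bounded_le : forall m n, (m <= n)%N -> {subset bounded m <= bounded n}.
Hypothesis bounded1 : 1 \in bounded 0.
Hypothesis boundedM : forall m n f g,
  f \in bounded m -> g \in bounded n -> f * g \in bounded (m + n)%N.

(** A relation that holds in [T] also holds modulo [p], so the family is independent in the span of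
    [box m]; more rows than columns in the coordinate matrix would give such a relation. *)
Lemma free_bounded_size (p : {pred T}) s m : 0 \in p ->
  free_mod C p s -> {subset s <= bounded m} -> (size s <= m.+1 ^ D)%N.
Proof.
move=> p0 sf sb; rewrite -box_size leqNgt; apply/negP => lt.
pose A := \matrix_(i < size s, j < size (box m)) cf s`_i (tnth (in_tuple (box m)) j).
have : kermx A != 0.
  rewrite kermx_eq0 /row_free; apply: contraL lt => /eqP <-.
  by rewrite -leqNgt rank_leq_col.
move=> /rowV0Pn[v /sub_kermxP vA vnz].
pose c i := if insub i is Some i' then v 0 i' else 0.
have cE (i : 'I_(size s)) : c i = v 0 i by rewrite /c valK.
have cf0 w : cf 0 w = 0 by apply: (addrI (cf 0 w)); rewrite -cfD !addr0.
have : \sum_(i < size s) C (c i) * s`_i \in p.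
  suff -> : \sum_(i < size s) C (c i) * s`_i = 0 by [].
  apply: cf_inj => w.
  have -> : cf (\sum_(i < size s) C (c i) * s`_i) w = \sum_(i < size s) v 0 i * cf s`_i w.
    rewrite (big_morph (cf^~ w) (id1 := 0) (op1 := +%R)) //.
    by apply: eq_bigr => i _; rewrite cfC cE.
  have [wb|wb] := boolP (w \in box m); last first.
    rewrite big1 // => i _; case: (eqVneq (cf s`_i w) 0) => [->|nz]; first by rewrite mulr0.
    have := sb _ (mem_nth 0 (ltn_ord i)) => /asboolP/(_ w nz).
    by rewrite (negPf wb).
  have wi : (index w (box m) < size (box m))%N by rewrite index_mem.
  have /matrixP/(_ 0 (Ordinal wi)) := vA; rewrite !mxE => vA0.
  rewrite -[RHS]vA0; apply: eq_bigr => i _.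
  by rewrite ?mxE (tnth_nth w) /= nth_index.
move=> /sf c0; move/eqP: vnz; apply; apply/rowP => i.
by rewrite mxE -cE c0.
Qed.

(** The family starts as [[:: 1]] at the top prime, where it is free because no nonzero scalar lies
    in that prime. Each step down the chain adjoins the powers of the witness [x] of strictness. *)
Lemma chain_length_le n (p : nat -> {pred T}) (x : nat -> T) :
  (forall i, {in p i &, forall f g, f - g \in p i}) ->
  (forall i f g, g \in p i -> f * g \in p i) ->
  (forall i f g, f * g \in p i -> f \in p i \/ g \in p i) ->
  (forall i, 0 \in p i) -> (forall i a, C a \in p i -> a = 0) ->
  (forall i, (i < n)%N ->
     [/\ {subset p i <= p i.+1}, x i \in p i.+1 & x i \notin p i]) ->
  (n <= D)%N.
Proof.
move=> pB pM pP p0 pC pS; rewrite leqNgt; apply/negP => Dn.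
have [E xE] : exists E, forall i, (i < n)%N -> x i \in bounded E.
  elim: n {pS Dn} => [|n [E IH]]; first by exists 0%N.
  have [m xm] := bounded_ex (x n); exists (maxn E m) => i.
  rewrite ltnS leq_eqVlt => /orP[/eqP ->|lt].
    exact: (bounded_le (leq_maxr _ _)) xm.
  exact: (bounded_le (leq_maxl _ _)) (IH i lt).
have fam N i : (i <= n)%N -> exists s, [/\ size s = (N ^ i)%N,
    {subset s <= bounded (i * (N * E))%N} & free_mod C (p (n - i)%N) s].
  elim: i => [_|i IH lin].
    exists [:: 1]; split=> // [f|c].
      by rewrite inE => /eqP ->.
    rewrite big_ord1 /= mulr1 => cp i; rewrite ltnS leqn0 => /eqP ->.
    exact: (pC (n - 0)%N).
  have [s [szs sb sf]] := IH (ltnW lin).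
  have lt : (n - i.+1 < n)%N by rewrite ltn_subrL /=; exact: leq_trans lin.
  have [pS' xp xnp] := pS _ lt; rewrite subnSK // in pS' xp.
  exists (iter N (fun t => s ++ [seq x (n - i.+1)%N * y | y <- t]) [::]).
  split; last exact: (free_mod_pows (pB _) (pB _) (pM _) (pP _) (p0 _) pS' xp xnp sf).
    rewrite expnS -szs; elim: {1 2}N => [|M IHM]; first by rewrite mul0n.
    by rewrite /= size_cat size_map IHM mulSn.
  rewrite mulSn addnC; elim: {1 3}N => [//|M IHM] f.
  rewrite iterS mem_cat => /orP[/sb|/mapP[y /IHM yb ->]].
    by apply: bounded_le; exact: leq_addr.
  have := boundedM (xE _ lt) yb; apply: bounded_le.
  by rewrite addnCA mulSn.
(* With this [N], [(n N E + 1)^D <= N^D (n E + 1)^D < N^(D+1) <= N^n], which contradicts the bound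
   on the size of a free family. *)
have [s [szs sb sf]] := fam ((n * E).+1 ^ D).+1 n (leqnn n).
have := free_bounded_size (p0 _) sf sb; rewrite szs.
set N := (_ ^ D).+1; have N0 : (0 < N)%N by [].
apply/negP; rewrite -ltnNge.
apply: (@leq_ltn_trans ((N * (n * E).+1) ^ D)%N).
  rewrite mulnS mulnCA -[(_ (n * E)).+1]add1n.
  by case: D => [|D']; rewrite ?expn0 // leq_exp2r // leq_add2r.
rewrite expnMn; apply: (@leq_trans (N ^ D.+1)%N); last by rewrite leq_pexp2l.
by rewrite expnS mulnC ltn_pmul2r ?expn_gt0.
Qed.

Variable Q : prime_idealr T.

Lemma localization_prime_chain_le n : prime_chain (localization Q) n -> (n <= D)%N.
Proof.
move=> [P PS].
(* Denominators are units, so each inclusion has a witness of strictness that comes from [T]; this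
   keeps the chain strict when it is pulled back along [iota]. *)
have [x xP] : exists x : nat -> T, forall i, (i < n)%N ->
    mk_frac (x i) (denom1 Q) \in P i.+1 /\ mk_frac (x i) (denom1 Q) \notin P i.
  have /choice[x xP] i : exists a : T, (i < n)%N ->
      mk_frac a (denom1 Q) \in P i.+1 /\ mk_frac a (denom1 Q) \notin P i.
    have [lt|_] := boolP (i < n)%N; last by exists 0.
    have [_ nsub] := PS i lt.
    have [z zP zN] : exists2 z, z \in P i.+1 & z \notin P i.
      apply: contra_notP nsub => H z zP; apply/negPn/negP => zN.
      by apply: H; exists z.
    elim/mk_fracW: z zP zN => a s aP aN; exists a => _.
    have aE : mk_frac a (denom1 Q) = mk_frac (sval s) (denom1 Q) * mk_frac a s.
      rewrite [RHS]loc_mulE.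
      by apply: (@mk_frac_eq _ _ _ _ _ _ (denom1 Q)) => /=; ring.
    have sE : mk_frac a s = mk_frac 1 s * mk_frac a (denom1 Q).
      rewrite [RHS]loc_mulE.
      by apply: (@mk_frac_eq _ _ _ _ _ _ (denom1 Q)) => /=; ring.
    split; first by rewrite aE idealMr.
    by apply: contra aN => aP'; rewrite sE idealMr.
  by exists x.
pose iota (a : T) : localization Q := mk_frac a (denom1 Q).
have iotaM a b : iota (a * b) = iota a * iota b.
  by rewrite [RHS]loc_mulE; apply: (@mk_frac_eq _ _ _ _ _ _ (denom1 Q)) => /=; ring.
have iotaB a b : iota (a - b) = iota a - iota b.
  transitivity (loc_add (iota a) (loc_opp (iota b))) => //.
  rewrite loc_oppE loc_addE.
  by apply: (@mk_frac_eq _ _ _ _ _ _ (denom1 Q)) => /=; ring.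
have iota0 : iota 0 = 0 by rewrite -(subrr 0) iotaB subrr.
have iota1 : iota 1 = 1 by [].
apply: (@chain_length_le _ (fun i => [pred a | iota a \in P i]) x).
- by move=> i a b; rewrite !inE iotaB => aP bP; rewrite rpredB.
- by move=> i a b; rewrite !inE iotaM => bP; rewrite idealMr.
- by move=> i a b; rewrite !inE iotaM prime_idealrM => /orP[]; [left|right].
- by move=> i; rewrite inE iota0 rpred0.
- move=> i a; rewrite inE => aP; apply/eqP; apply/negPn/negP => a0.
  have /negP := idealr1 (P i); apply.
  have -> : 1 = iota (C a^-1) * iota (C a).
    by rewrite -iotaM -rmorphM mulVf // rmorph1.
  by rewrite idealMr.
- move=> i lt; have [xi xi'] := xP i lt; split => //.
  by move=> a; rewrite !inE; apply: (PS i lt).1.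
Qed.

End KrullUpperBound.

(** * Chains of primes that survive localization *)

Section LocalizedPrimes.
Variables (A : comNzRingType) (Q : prime_idealr A).

(** A prime inside [Q] is saturated with respect to [Q], so its extension is prime and remembers
    it. *)
Lemma localization_prime_chain (p : nat -> prime_idealr A) n :
  (forall i, {subset p i <= Q}) ->
  (forall i, (i < n)%N -> {subset p i <= p i.+1} /\ ~ {subset p i.+1 <= p i}) ->
  prime_chain (localization Q) n.
Proof.
move=> pQ pS.
have psub i : submod_closed (p i : {pred A^o}).
  split=> [|b x y xp yp]; first exact: rpred0.
  by apply: (@rpredD _ (p i)) => //; exact: idealMr.
pose W i : submodClosed A^o := HB.pack_for (submodClosed A^o) (p i : {pred A^o})
  (GRing.isSubmodClosed.Build _ A^o (p i : {pred A^o}) (psub i)).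
have Wsat i : saturated Q (W i).
  move=> u a uQ; change (u * a \in p i -> a \in p i).
  rewrite prime_idealrM => /orP[/pQ uQ'|//]; by rewrite uQ' in uQ.
have mem i a s : (mk_frac a s \in loc_ideal Q (W i)) = (a \in p i).
  exact: mem_loc_ideal.
have idl i : idealr_closed (loc_ideal Q (W i) : {pred localization Q}).
  split; first exact: rpred0.
    by rewrite [1]/(mk_frac 1 (denom1 Q)) mem idealr1.
  move=> a x y xW yW; apply: (@submod_idealD (localization Q)) => //.
  exact: (@submod_idealMl (localization Q)).
have prm i : prime_idealr_closed (loc_ideal Q (W i) : {pred localization Q}).
  elim/mk_fracW=> a s; elim/mk_fracW=> b t.
  rewrite [X in X \in _]loc_mulE !mem prime_idealrM => /orP[] ->; rewrite ?orbT //.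
pose P i : prime_idealr (localization Q) :=
  HB.pack_for (prime_idealr (localization Q)) (loc_ideal Q (W i) : {pred localization Q})
    (isIdealr.Build _ (loc_ideal Q (W i) : {pred localization Q}) (idl i))
    (isPrimeIdealrClosed.Build _ (loc_ideal Q (W i) : {pred localization Q}) (prm i)).
exists P => i lt; have [s ns] := pS i lt; split.
  by elim/mk_fracW=> a t; change (mk_frac a t \in loc_ideal Q (W i) ->
     mk_frac a t \in loc_ideal Q (W i.+1)); rewrite !mem; exact: s.
move=> H; apply: ns => a aP; have := H (mk_frac a (denom1 Q)).
change ((mk_frac a (denom1 Q) \in loc_ideal Q (W i.+1) ->
     mk_frac a (denom1 Q) \in loc_ideal Q (W i)) -> a \in p i).
by rewrite !mem; apply.
Qed.

End LocalizedPrimes.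

(** * Membership by monomials, and divisibility of monomials *)

Section FinitelySupported.
Variables (k : fieldType) (T : comNzRingType) (C : {rmorphism k -> T}).
Variables (I : eqType) (cf : T -> I -> k).
Hypothesis cfD : forall f g w, cf (f + g) w = cf f w + cf g w.
Hypothesis cfC : forall a f w, cf (C a * f) w = a * cf f w.
Hypothesis cf_inj : forall f, (forall w, cf f w = 0) -> f = 0.
Hypothesis cf_finite : forall f, exists s : seq I, forall w, cf f w != 0 -> w \in s.

(** Subtracting one monomial of the support at a time reduces membership in [W] to single exponents;
    the hard inclusions for powers and Frobenius powers rest on this. *)
Lemma mem_monomials (W : submodClosed T^o) f :
  (forall w, cf f w != 0 ->
     exists2 X, X \in W & forall v, cf X v = (v == w)%:R) -> f \in W.
Proof.
have [s] := cf_finite f; elim: s f => [|w s IH] f fs H.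
  have -> : f = 0 by apply: cf_inj => w; apply/eqP; apply/negPn/negP => /fs.
  exact: (@rpred0 T^o W).
have cf0 v : cf 0 v = 0 by apply: (addrI (cf 0 v)); rewrite -cfD !addr0.
have cfN h v : cf (- h) v = - cf h v.
  by apply: (addrI (cf h v)); rewrite -cfD !subrr cf0.
have [fw0|fw] := eqVneq (cf f w) 0.
  apply: IH => // v nz; have := fs _ nz; rewrite inE => /orP[/eqP vw|//].
  by rewrite vw fw0 eqxx in nz.
have [X XW XE] := H w fw.
have cfE v : cf (f - C (cf f w) * X) v = if v == w then 0 else cf f v.
  rewrite cfD cfN cfC XE; case: eqP => [->|_]; first by rewrite mulr1 subrr.
  by rewrite mulr0 subr0.
rewrite -[f](subrK (C (cf f w) * X)); apply: submod_idealD; last exact: submod_idealMl.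
apply: IH => v; rewrite cfE; case: (eqVneq v w) => [_|vw]; rewrite ?eqxx // => nz;
  last exact: (H v nz).
by have := fs _ nz; rewrite inE (negPf vw).
Qed.

End FinitelySupported.

Section Multinomials.
Variable d : nat.
Implicit Types u v : multinom d.

Lemma mnm_split u a : (a <= mdeg u)%N -> exists2 v, lem v u & mdeg v = a.
Proof.
elim: a => [_|a IH lt].
  by exists (mnm0); [apply/mnm_lepP => i; rewrite mnm0E|exact: mdeg0].
have [v /mnm_lepP vu vE] := IH (ltnW lt).
have [i vi] : exists i, (v i < u i)%N.
  apply/existsP; apply: contraTT lt; rewrite negb_exists => /forallP H.
  rewrite -vE -leqNgt.
  by rewrite !mdegE; apply: leq_sum => i _; have := H i; rewrite -leqNgt.
exists (mnm_add v (mnm1 i)); last by rewrite mdegD mdeg1 vE addn1.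
apply/mnm_lepP => j; rewrite mnmDE mnm1E; case: eqP => [<-|_]; first by rewrite addn1.
by rewrite addn0.
Qed.

(** The right side says that the [q]-th power of a monomial of degree [a] divides [x^u]. The floors
    on the left are the coordinates of the cell of [u], which is how cells enter the count. *)
Lemma mnm_div_split u q a : (0 < q)%N ->
  (a <= \sum_i (u i %/ q))%N <->
  exists2 v, mdeg v = a & forall i, (v i * q <= u i)%N.
Proof.
move=> q0; split=> [le|[v <- vu]].
  have [v /mnm_lepP vu vE] : exists2 v, lem v (Multinom [tuple (u i %/ q)%N | i < d]) & mdeg v = a.
    apply: mnm_split; rewrite mdegE; apply: leq_trans le _.
    by apply: leq_sum => i _; rewrite mnmE.
  exists v => // i; have := vu i; rewrite mnmE => /leq_trans; rewrite -leq_divRL //; exact.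
by rewrite mdegE; apply: leq_sum => i _; rewrite leq_divRL.
Qed.

Lemma mcoeffM_neq0 (k : fieldType) (f g : mpoly d k) u : mcoeff u (f * g) != 0 ->
  exists v w, [/\ u = mnm_add v w, mcoeff v f != 0 & mcoeff w g != 0].
Proof.
rewrite -mcoeff_msupp => /msuppM_le /allpairsP[[v w] /= [vf wg ->]].
by exists v, w; rewrite -!mcoeff_msupp.
Qed.

End Multinomials.

(** * Monomials of the Veronese ring and powers of its maximal ideal *)

Section VeroneseMonomials.
Variables (k : fieldType) (d c : nat).
Local Notation A := (veronese k d c).
Local Notation m := (veronese_max k d c).
Local Notation x_ u := (mpolyX k u).

Lemma const_veronese_zmod_morphism : zmod_morphism (const_veronese (k:=k) d c).
Proof. by move=> a b; apply: val_inj; rewrite /= scalerBl. Qed.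

Lemma const_veronese_monoid_morphism : monoid_morphism (const_veronese (k:=k) d c).
Proof.
split; first by apply: val_inj; rewrite /= scale1r.
by move=> a b; apply: val_inj; rewrite /= -scalerAl mul1r scalerA.
Qed.

HB.instance Definition _ := GRing.isZmodMorphism.Build k A
  (const_veronese (k:=k) d c) const_veronese_zmod_morphism.
HB.instance Definition _ := GRing.isMonoidMorphism.Build k A
  (const_veronese (k:=k) d c) const_veronese_monoid_morphism.

Definition vcoef (f : A) u := mcoeff u (veronese_val f).

Lemma vcoefD f g u : vcoef (f + g) u = vcoef f u + vcoef g u.
Proof. exact: mcoeffD. Qed.

Lemma vcoefC a f u : vcoef (const_veronese d c a * f) u = a * vcoef f u.
Proof. by rewrite /vcoef /= -scalerAl mul1r mcoeffZ. Qed.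

Lemma vcoef_inj f : (forall u, vcoef f u = 0) -> f = 0.
Proof. by move=> H; apply: val_inj; apply/mpolyP => u; rewrite /= mcoeff0 -(H u). Qed.

Lemma vcoef_finite f : exists s : seq (multinom d), forall u, vcoef f u != 0 -> u \in s.
Proof. by exists (msupp (veronese_val f)) => u; rewrite mcoeff_msupp. Qed.

Lemma vcoef_dvd f u : vcoef f u != 0 -> (c %| mdeg u)%N.
Proof.
elim/veronese_ind: f u => [a f fa u | f [v vc fv] u | f g IHf IHg u | f g IHf IHg u].
- rewrite /vcoef fa mcoeffZ mcoeff1; case: (eqVneq u (mnm0)) => [->|_].
    by rewrite mdeg0 dvdn0.
  by rewrite mulr0 eqxx.
- rewrite /vcoef fv mcoeffX; case: (eqVneq v u) => [<-|_]; first by rewrite vc.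
  by rewrite eqxx.
- have [fu0|fu _] := eqVneq (vcoef f u) 0; last exact: IHf.
  by rewrite vcoefD fu0 add0r; exact: IHg.
- by move=> /mcoeffM_neq0[v [w [-> /IHf fv /IHg gw]]]; rewrite mdegD dvdn_add.
Qed.

Lemma vcoef_max f u : f \in m -> vcoef f u != 0 -> (c <= mdeg u)%N.
Proof.
move=> /ideal_genP[n [a [g [Gg ->]]]].
rewrite /vcoef raddf_sum /= raddf_sum /= => nz.
have [i nzi] : exists i, mcoeff u (veronese_val (a i) * veronese_val (g i)) != 0.
  apply/existsP; apply: contraNT nz; rewrite negb_exists => /forallP H.
  by rewrite big1 // => i _; apply/eqP; have := H i; rewrite negbK; exact.
move: nzi => /mcoeffM_neq0[v [w [-> _]]].
have [z zc ->] := Gg i; rewrite mcoeffX; case: (eqVneq z w) => [<- _|_]; last by rewrite eqxx.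
by rewrite mdegD zc leq_addl.
Qed.

Lemma vcoef_exp j f u : f \in ideal_exp m j -> vcoef f u != 0 -> (c * j <= mdeg u)%N.
Proof.
move=> /ideal_genP[n [a [g [Gg ->]]]].
rewrite /vcoef raddf_sum /= raddf_sum /= => nz.
have [i nzi] : exists i, mcoeff u (veronese_val (a i) * veronese_val (g i)) != 0.
  apply/existsP; apply: contraNT nz; rewrite negb_exists => /forallP H.
  by rewrite big1 // => i _; apply/eqP; have := H i; rewrite negbK; exact.
move: nzi => /mcoeffM_neq0[v [w [-> _]]]; rewrite mdegD => gw.
apply: leq_trans (leq_addl _ _); have [h hm gE] := Gg i; move: gw; rewrite gE.
elim: j h hm w {Gg gE} => [|j IH] h hm w; first by rewrite muln0.
rewrite big_ord_recl => /mcoeffM_neq0[y [z [-> /(vcoef_max (hm _)) le1]]].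
move=> /(IH (fun r => h (lift ord0 r)) (fun r => hm _)) le2.
by rewrite mdegD mulnS leq_add.
Qed.

Hypothesis c_gt0 : (0 < c)%N.

(** Peeling a divisor of degree [c] off [x^u] leaves a degree that is again a multiple of [c] and
    lowers the required power of [m] by one. *)
Lemma veronese_monomial_exp j u : (c %| mdeg u)%N -> (c * j <= mdeg u)%N ->
  exists2 X : A, X \in ideal_exp m j & veronese_val X = x_ u.
Proof.
have mon1 v : mdeg v = c -> exists2 X : A, X \in ideal_exp m 1 & veronese_val X = x_ v.
  move=> vc; have vV : x_ v \in veronese_pred c.
    by apply/veronese_predP => S SG; apply: SG; exists v.
  exists (Veronese vV) => //; apply: mem_ideal_gen; exists (fun=> Veronese vV).
    by move=> _; apply: mem_ideal_gen; exists v.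
  by rewrite big_ord1.
move: {2}(mdeg u) (leqnn (mdeg u)) => n; elim: n j u => [|n IH] j u.
  rewrite leqn0 mdeg_eq0 => /eqP -> _; rewrite mdeg0 leqn0 muln_eq0.
  rewrite (gtn_eqF c_gt0) /= => /eqP ->.
  by exists 1; [exact: ideal_exp0 | rewrite /= mpolyX0].
move=> un cu le; have [cu0|cule] := ltnP (mdeg u) c.
  by apply: IH => //; move: cu; rewrite /dvdn modn_small // => /eqP ->.
have [v /mnm_lepP vu vc] := mnm_split cule.
have uE : u = mnm_add v (mnm_sub u v).
  by apply/mnmP => i; rewrite mnmDE mnmBE subnKC.
have dE : mdeg u = (c + mdeg (mnm_sub u v))%N by rewrite {1}uE mdegD vc.
have [X Xm XE] := mon1 v vc.
have [||| Y Ym YE] := IH j.-1 (mnm_sub u v).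
- by move: un; rewrite dE; lia.
- by move: cu; rewrite dE dvdn_addr.
- by move: le; rewrite dE; case: (j) => [|j'] /=; rewrite ?muln0 // mulnS leq_add2l.
exists (X * Y); last by rewrite /= XE YE -mpolyXD -uE.
case: j le Ym => [|j] _ Ym; first exact: ideal_exp0.
exact: (ideal_expD Xm Ym).
Qed.

Lemma mem_veronese_exp n f :
  f \in ideal_exp m n <-> forall u, (mdeg u < c * n)%N -> vcoef f u = 0.
Proof.
split=> [fm u lt|H].
  by apply/eqP; apply: contraLR lt => nz; rewrite -leqNgt; exact: vcoef_exp nz.
apply: (mem_monomials vcoefD vcoefC vcoef_inj vcoef_finite) => u nz.
have [||X Xm XE] := @veronese_monomial_exp n u.
- exact: vcoef_dvd nz.
- by rewrite leqNgt; apply: contra nz => /H ->.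
by exists X => // v; rewrite /vcoef XE mcoeffX eq_sym.
Qed.

End VeroneseMonomials.

(** * Monomials of the Rees algebra and Frobenius powers *)

Section ReesMonomials.
Variables (k : fieldType) (d c : nat).
Local Notation A := (veronese k d c).
Local Notation m := (veronese_max k d c).
Local Notation RR := (rees m).
Local Notation x_ u := (mpolyX k u).
Local Notation expo := (multinom d * nat)%type.

Definition rees_scalar (a : k) : RR := rees_const (const_veronese d c a).

Lemma rees_scalar_zmod_morphism : zmod_morphism rees_scalar.
Proof. by move=> a b; apply: val_inj; rewrite /= raddfB /= polyCB. Qed.

Lemma rees_scalar_monoid_morphism : monoid_morphism rees_scalar.
Proof.
split; first by apply: val_inj; rewrite /= rmorph1 polyC1.
by move=> a b; apply: val_inj; rewrite /= rmorphM /= polyCM.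
Qed.

HB.instance Definition _ :=
  GRing.isZmodMorphism.Build k RR rees_scalar rees_scalar_zmod_morphism.
HB.instance Definition _ :=
  GRing.isMonoidMorphism.Build k RR rees_scalar rees_scalar_monoid_morphism.

(** The embedding of [R(m)] into [k[x][t]], where products, substitutions and [p]-th powers are
    computed. *)
Definition rees_poly : RR -> {poly mpoly d k} :=
  map_poly (@veronese_val k d c) \o @rees_val A m.

HB.instance Definition _ := GRing.RMorphism.on rees_poly.

Definition rcoef (f : RR) (w : expo) : k := mcoeff w.1 (rees_poly f)`_w.2.

Lemma rcoefE f w : rcoef f w = vcoef (rees_val f)`_w.2 w.1.
Proof. by rewrite /rcoef coef_map. Qed.

Lemma rcoefD f g w : rcoef (f + g) w = rcoef f w + rcoef g w.
Proof. by rewrite /rcoef rmorphD coefD mcoeffD. Qed.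

Lemma rcoefC a f w : rcoef (rees_scalar a * f) w = a * rcoef f w.
Proof. by rewrite !rcoefE /= coefCM vcoefC. Qed.

Lemma rcoef_inj f : (forall w, rcoef f w = 0) -> f = 0.
Proof.
move=> H; apply: val_inj; apply/polyP => i; rewrite coef0; apply: vcoef_inj => u.
by rewrite -(H (u, i)) rcoefE.
Qed.

Lemma rcoef_finite f : exists s : seq expo, forall w, rcoef f w != 0 -> w \in s.
Proof.
exists [seq (u, j) | j <- iota 0 (size (rees_poly f)), u <- msupp (rees_poly f)`_j].
move=> [u j] nz; apply/allpairsPdep; exists j, u; split=> //; last by rewrite mcoeff_msupp.
rewrite mem_iota /= ltnNge; apply: contra nz => le.
by rewrite /rcoef /= nth_default // mcoeff0.
Qed.

Definition expo_add (v w : expo) : expo := (mnm_add v.1 w.1, (v.2 + w.2)%N).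

Lemma rcoefM_neq0 f g w : rcoef (f * g) w != 0 ->
  exists v w', [/\ w = expo_add v w', rcoef f v != 0 & rcoef g w' != 0].
Proof.
rewrite /rcoef rmorphM coefM raddf_sum /= => nz.
have [i] : exists i : 'I_w.2.+1,
    mcoeff w.1 ((rees_poly f)`_i * (rees_poly g)`_(w.2 - i)) != 0.
  apply/existsP; apply: contraNT nz; rewrite negb_exists => /forallP H.
  by rewrite big1 // => i _; apply/eqP; have := H i; rewrite negbK; exact.
move=> /mcoeffM_neq0[u [v [wE fu gv]]].
exists (u, i : nat), (v, (w.2 - i)%N); split=> //; rewrite /expo_add /= -wE.
by rewrite subnKC -?surjective_pairing // -ltnS.
Qed.

Definition cone (w : expo) : bool := (c %| mdeg w.1)%N && (c * w.2 <= mdeg w.1)%N.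

Lemma rcoef_cone f w : rcoef f w != 0 -> cone w.
Proof.
rewrite rcoefE => nz; apply/andP; split; first exact: vcoef_dvd nz.
apply: vcoef_exp nz; have /rees_predP := valP f; exact.
Qed.

Lemma monomial_rees_pred (Y : A) j : Y \in ideal_exp m j -> Y *: 'X^j \in rees_pred m.
Proof.
move=> Ym; apply/rees_predP => i; rewrite coefZ coefXn.
by case: eqP => [->|_]; rewrite ?mulr1 // mulr0 rpred0.
Qed.

Lemma rees_poly_monomial X (Y : A) j u : rees_val X = Y *: 'X^j ->
  veronese_val Y = x_ u -> rees_poly X = x_ u *: 'X^j.
Proof. by rewrite /rees_poly /= => -> YE; rewrite map_polyZ /= YE map_polyXn. Qed.

Lemma rcoef_monomial X u j : rees_poly X = x_ u *: 'X^j ->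
  forall v, rcoef X v = (v == (u, j))%:R.
Proof.
move=> XE [v i]; rewrite /rcoef XE /= coefZ coefXn xpair_eqE.
case: (i == j); first by rewrite mulr1 mcoeffX andbT eq_sym.
by rewrite mulr0 mcoeff0 andbF.
Qed.

Hypothesis c_gt0 : (0 < c)%N.

Lemma rees_monomial w : cone w -> exists X : RR, rees_poly X = x_ w.1 *: 'X^(w.2).
Proof.
move=> /andP[cw le]; have [Y Ym YE] := veronese_monomial_exp k c_gt0 cw le.
by exists (Rees (monomial_rees_pred Ym)); exact: (@rees_poly_monomial _ Y).
Qed.

(** [|u|] is a multiple of [c], so [|u| < c] forces [u = 0], and the cone inequality then forces
    [j = 0]. *)
Lemma cone_deg w : cone w -> w != (mnm0, 0%N) -> (c <= mdeg w.1)%N.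
Proof.
case: w => u j /andP[/= cu le]; apply: contraR; rewrite -ltnNge => lt.
have u0 : mdeg u = 0%N by move: cu; rewrite /dvdn modn_small // => /eqP.
move: le; rewrite u0 leqn0 muln_eq0 (gtn_eqF c_gt0) /= => /eqP ->.
by move/eqP: u0; rewrite mdeg_eq0 => /eqP ->.
Qed.

Lemma rcoef_max f w : f \in rees_max m -> rcoef f w != 0 -> (c <= mdeg w.1)%N.
Proof.
move=> fM nz; apply: (cone_deg (rcoef_cone nz)); apply: contraNneq nz => ->.
by rewrite rcoefE /vcoef /= rees_max_coeff0.
Qed.

Variables (p : nat) (p_char : p \in [pchar k]).

(** Raising to the power [p^e] is additive in characteristic [p], so no mixed terms appear and
    exponents are simply scaled. *)
Lemma mcoeff_frobenius (f : mpoly d k) e u : mcoeff u (f ^+ (p ^ e)) != 0 ->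
  exists2 v, mcoeff v f != 0 & u = mnm_muln v (p ^ e)%N.
Proof.
have pc : p \in [pchar mpoly d k] := rmorph_pchar (mpolyC d (R:=k)) p_char.
have pn : [pchar mpoly d k].-nat (p ^ e)%N.
  by rewrite pnatX (pnatE _ (pcharf_prime p_char)) pc.
have q0 : (0 < p ^ e)%N by rewrite expn_gt0 prime_gt0 // (pcharf_prime p_char).
rewrite {1}[f]mpolyE; elim: (msupp f) => [|v s IH].
  by rewrite big_nil expr0n gtn_eqF // mcoeff0 eqxx.
rewrite big_cons exprDn_pchar // mcoeffD exprZn mpolyXn mcoeffZ mcoeffX.
have [uE|_] := eqVneq (mnm_muln v (p ^ e)) u; last by rewrite mulr0 add0r.
have [->|nz _] := eqVneq (mcoeff v f) 0; last by exists v.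
by rewrite expr0n gtn_eqF // mulr0n mul0r add0r.
Qed.

Lemma rcoef_frobenius f e w : rcoef (f ^+ (p ^ e)) w != 0 ->
  exists2 v, rcoef f v != 0 & w = (mnm_muln v.1 (p ^ e)%N, (v.2 * p ^ e)%N).
Proof.
have pc : p \in [pchar {poly mpoly d k}].
  exact: (rmorph_pchar (polyC (R:=mpoly d k)) (rmorph_pchar (mpolyC d (R:=k)) p_char)).
have pn : [pchar {poly mpoly d k}].-nat (p ^ e)%N.
  by rewrite pnatX (pnatE _ (pcharf_prime p_char)) pc.
have q0 : (0 < p ^ e)%N by rewrite expn_gt0 prime_gt0 // (pcharf_prime p_char).
rewrite /rcoef rmorphXn /=; case: w => u j /=.
rewrite -[X in (X ^+ _)]coefK poly_def.
elim: (size (rees_poly f)) => [|n IH].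
  by rewrite big_ord0 expr0n gtn_eqF // coef0 mcoeff0 eqxx.
rewrite big_ord_recr exprDn_pchar //= coefD mcoeffD exprZn coefZ -exprM coefXn.
have [jE|_] := eqVneq j (n * p ^ e)%N; last by rewrite mulr0 mcoeff0 addr0.
rewrite mulr1.
have [->|nz _] := eqVneq (mcoeff u ((rees_poly f)`_n ^+ (p ^ e))) 0.
  by rewrite addr0.
by have [v vnz ->] := mcoeff_frobenius nz; exists (v, n) => //=; rewrite jE.
Qed.

(* For w = (u, j) in the cone: x^u t^j is a multiple of the q-th power of some
   x^v or x^v t with |v| = c. *)
Definition frob_exp q (w : expo) : bool :=
  (c <= \sum_i (w.1 i %/ q))%N && ((q <= w.2)%N || (c * (w.2 + q) <= mdeg w.1)%N).

(** Both kinds of generators of [M] at once: [x^v] for [b = false] and [x^v t] for [b = true]. *)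
Lemma rees_gen (v : multinom d) (b : bool) : mdeg v = c ->
  exists2 X : RR, X \in rees_max m & rees_poly X = x_ v *: 'X^b.
Proof.
move=> vc; have vV : x_ v \in veronese_pred c.
  by apply/veronese_predP => S SG; apply: SG; exists v.
pose Y : A := Veronese vV; have Ym : Y \in m by apply: mem_ideal_gen; exists v.
have Yb : Y \in ideal_exp m b.
  case: b; last exact: ideal_exp0.
  by apply: mem_ideal_gen; exists (fun=> Y); rewrite ?big_ord1.
exists (Rees (monomial_rees_pred Yb)); last exact: (@rees_poly_monomial _ Y).
apply: mem_ideal_gen; exists Y => //; case: (b) Yb => Yb /=; first by right.
by left; rewrite expr0 alg_polyC.
Qed.

Lemma mem_frobenius_rees e (f : RR) : f \in frobenius_power (rees_max m) (p ^ e) <->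
  forall w, cone w -> ~~ frob_exp (p ^ e) w -> rcoef f w = 0.
Proof.
have q0 : (0 < p ^ e)%N by rewrite expn_gt0 prime_gt0 // (pcharf_prime p_char).
set q := (p ^ e)%N in q0 *; split=> [/ideal_genP[n [a [g [Gg ->]]]] w wc wF|H].
  apply/eqP; apply: contraNT wF => nz.
  have [i] : exists i, rcoef (a i * g i) w != 0.
    apply/existsP; apply: contraNT nz; rewrite negb_exists => /forallP H.
    have -> : rcoef (\sum_i a i * g i) w = \sum_i rcoef (a i * g i) w.
      apply: (big_morph (rcoef^~ w)) => [x y|]; first exact: rcoefD.
      by rewrite /rcoef rmorph0 coef0 mcoeff0.
    by rewrite big1 // => i _; have := H i; rewrite negbK => /eqP.
  have [x /= xM xE] := Gg i; rewrite -xE => /rcoefM_neq0[w' [v0 [-> /rcoef_cone/andP[w'd w'c]]]].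
  move=> /rcoef_frobenius[v vnz ->].
  have vd := rcoef_max xM vnz; have /andP[_ vc] := rcoef_cone vnz.
  have muln_E i' : (mnm_muln v.1 q) i' = (v.1 i' * q)%N by exact: mulmnE.
  apply/andP; split.
    rewrite (mnm_div_split _ _ q0).
    have [v' /mnm_lepP v'v v'c] := mnm_split vd; exists v' => // i'.
    rewrite /= mnmDE muln_E; apply: leq_trans (leq_addl _ _).
    by rewrite leq_mul2r v'v orbT.
  (* If [t] occurs in the base of the power, [t^q] divides the monomial; otherwise the power uses up
     degree [c q] in [x] and no [t], which gives the second alternative. *)
  rewrite /= mdegD mdegMn; case: (v.2) vc => [|v2] vc; last first.
    by rewrite mulSn addnCA leq_addr.
  apply/orP; right; rewrite mul0n addn0 mulnDr; apply: leq_add => //.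
  by rewrite leq_mul2r vd orbT.
apply: (mem_monomials rcoefD rcoefC rcoef_inj rcoef_finite) => w nz.
have wc := rcoef_cone nz.
have /andP[] : frob_exp q w by apply: contraNT nz => /(H w wc) ->.
rewrite (mnm_div_split _ _ q0) => -[v vc vw] wF.
(* Divide by [(x^v t)^q] when [q <= j] and by [(x^v)^q] otherwise. In the latter case the second
   alternative of [frob_exp] is exactly what keeps the quotient in the cone. *)
have [w' [b [w'c wE]]] : exists w' (b : bool), cone w' /\
    w = expo_add w' (mnm_muln v q, (b * q)%N).
  have uE : w.1 = mnm_add (mnm_sub w.1 (mnm_muln v q)) (mnm_muln v q).
    by apply/mnmP => i; rewrite mnmDE mnmBE mulmnE subnK.
  have dE : mdeg w.1 = (mdeg (mnm_sub w.1 (mnm_muln v q)) + c * q)%N.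
    by rewrite {1}uE mdegD mdegMn vc.
  move: wc => /andP[wd wc].
  exists (mnm_sub w.1 (mnm_muln v q), (w.2 - (q <= w.2) * q)%N), (q <= w.2)%N.
  have le : ((q <= w.2) * q <= w.2)%N by case E: (q <= w.2)%N; rewrite ?mul1n ?mul0n.
  split; last by rewrite /expo_add /= -uE subnK // -surjective_pairing.
  apply/andP; split=> /=.
    by move: wd; rewrite dE dvdn_addl // dvdn_mulr.
  move: wF wc; rewrite dE; case: (leqP q w.2) => _ /=; rewrite ?mul1n ?mul0n ?subn0.
    by move=> _ wc; rewrite mulnBr leq_subLR addnC.
  by rewrite mulnDr leq_add2r.
have [X XE] := rees_monomial w'c; have [h hM hE] := rees_gen b vc.
exists (X * h ^+ q).
  by apply: submod_idealMl; apply: mem_ideal_gen; exists h.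
have E : rees_poly (X * h ^+ q) = x_ w.1 *: 'X^(w.2).
  rewrite rmorphM rmorphXn /= XE hE exprZn -exprM mpolyXn wE /expo_add /=.
  by rewrite mpolyXD exprD -scalerAl -scalerAr scalerA mulrC.
by rewrite [w]surjective_pairing; exact: rcoef_monomial.
Qed.

(** Hence standard exponents are closed under division inside the cone, as [cf_deg] demands. *)
Lemma frob_exp_add q v w : cone v -> frob_exp q w -> frob_exp q (expo_add v w).
Proof.
move=> /andP[_ vc] /andP[le H]; apply/andP; split=> /=.
  apply: leq_trans le _; apply: leq_sum => i _.
  by rewrite mnmDE leq_div2r // leq_addl.
case/orP: H => H; first by rewrite (leq_trans H) // leq_addl.
by rewrite mdegD -addnA mulnDr leq_add // orbT.
Qed.

End ReesMonomials.

(** * Exponents with bounded coordinates *)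

Section Boxes.
Variables (d N : nat).

Definition box_mnm (f : {ffun 'I_d -> 'I_N}) : multinom d :=
  Multinom [tuple (f i : nat) | i < d].

Lemma box_mnmE f i : box_mnm f i = f i.
Proof. exact: mnmE. Qed.

Lemma box_mnm_inj : injective box_mnm.
Proof.
by move=> f g /mnmP e; apply/ffunP => i; apply: val_inj; have := e i; rewrite !box_mnmE.
Qed.

Lemma mdeg_box f : mdeg (box_mnm f) = (\sum_i f i)%N.
Proof. by rewrite mdegE; apply: eq_bigr => i _; rewrite box_mnmE. Qed.

Lemma box_mnm_ex (u : multinom d) : (forall i, (u i < N)%N) -> exists f, u = box_mnm f.
Proof.
move=> H; exists [ffun i => Ordinal (H i)]; apply/mnmP => i.
by rewrite box_mnmE ffunE.
Qed.

End Boxes.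

(** * Krull dimension of the localized Rees algebra *)

Section KrullDimension.
Variables (k : fieldType) (d c : nat) (d_gt0 : (0 < d)%N) (c_gt0 : (0 < c)%N).
Local Notation RR := (rees (veronese_max k d c)).
Local Notation x_ u := (mpolyX k u).
Local Notation expo := (multinom d * nat)%type.
Local Notation M := (veronese_rees_prime k d c_gt0).

Lemma rees_max_coef (f : RR) : (f \in M) = (rcoef f (mnm0, 0%N) == 0).
Proof.
apply/idP/eqP => [fM|f0].
  by rewrite rcoefE /vcoef; exact: (rees_max_coeff0 c_gt0).
have [a fa] := rees_decomp f.
have : rcoef (f - rees_scalar d c a) (mnm0, 0%N) = 0.
  by rewrite rcoefE /vcoef; exact: (rees_max_coeff0 c_gt0).
have -> : f - rees_scalar d c a = f + rees_scalar d c (- a) * 1.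
  by rewrite mulr1 rmorphN.
rewrite rcoefD rcoefC f0 add0r /rcoef rmorph1 coef1 mcoeff1 eqxx mulr1 => /eqP.
rewrite oppr_eq0 => /eqP a0; move: fa; rewrite a0.
by rewrite -/(rees_scalar d c 0) rmorph0 subr0.
Qed.

Definition expo_box n : seq expo :=
  [seq (box_mnm f, j) | f <- enum {ffun 'I_d -> 'I_n.+1}, j <- iota 0 n.+1].

Lemma size_expo_box n : size (expo_box n) = (n.+1 ^ d.+1)%N.
Proof.
by rewrite size_allpairs size_iota -cardE card_ffun !card_ord expnSr.
Qed.

Lemma mem_expo_box n w :
  (w \in expo_box n) = [forall i, (w.1 i <= n)%N] && (w.2 <= n)%N.
Proof.
apply/allpairsPdep/andP => [[f [j [_ jn ->]]]|[/forallP un jn]].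
  split=> /=; last by move: jn; rewrite mem_iota.
  by apply/forallP => i; rewrite box_mnmE -ltnS.
have [f fE] : exists f, w.1 = box_mnm (N := n.+1) f by apply: box_mnm_ex => i; rewrite ltnS.
exists f, w.2; split; [by rewrite mem_enum|by rewrite mem_iota|].
by rewrite -fE -surjective_pairing.
Qed.

Lemma rees_prime_chain_le n : prime_chain (localization M) n -> (n <= d.+1)%N.
Proof.
have boxP (f : RR) m : reflect (forall w, rcoef f w != 0 -> w \in expo_box m)
    (f \in bounded (@rcoef k d c) expo_box m) by exact: asboolP.
apply: (@localization_prime_chain_le _ _ (rees_scalar (k:=k) d c) _ (@rcoef k d c) expo_box d.+1).
- exact: rcoefD.
- exact: rcoefC.
- exact: rcoef_inj.
- exact: size_expo_box.
- move=> f; have [s fs] := rcoef_finite f.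
  exists (\max_(w <- s) maxn (\max_i w.1 i) w.2); apply/boxP => w /fs ws.
  have le : (maxn (\max_i w.1 i) w.2 <= \max_(w <- s) maxn (\max_i w.1 i) w.2)%N.
    exact: (@leq_bigmax_seq _ s xpredT (fun w : expo => maxn (\max_i w.1 i) w.2) w ws).
  rewrite mem_expo_box (leq_trans (leq_maxr _ _) le) andbT; apply/forallP => i.
  apply: leq_trans le; apply: leq_trans (leq_maxl _ _).
  exact: (@leq_bigmax _ (fun i => w.1 i)).
- move=> a b ab f /boxP fa; apply/boxP => w /fa; rewrite !mem_expo_box.
  move=> /andP[/forallP wa wa2]; rewrite (leq_trans wa2 ab) andbT.
  by apply/forallP => i; exact: leq_trans ab.
- apply/boxP => -[u j]; rewrite /rcoef rmorph1 coef1 /=.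
  case: (eqVneq j 0%N) => [->|_]; last by rewrite mcoeff0 eqxx.
  rewrite mcoeff1; case: (eqVneq u mnm0) => [->|_]; last by rewrite eqxx.
  by rewrite mem_expo_box /= andbT => _; apply/forallP => i; rewrite mnm0E.
- move=> a b f g /boxP fa /boxP gb; apply/boxP => w.
  move=> /rcoefM_neq0[v [w' [-> /fa va /gb wb]]]; move: va wb.
  rewrite !mem_expo_box => /andP[/forallP va va2] /andP[/forallP wb wb2] /=.
  rewrite leq_add // andbT; apply/forallP => i.
  by rewrite mnmDE leq_add.
Qed.

Definition kill_vars a : d.-tuple (mpoly d k) :=
  [tuple if (i < a)%N then 0 else mpolyX k (mnm1 i) | i < d].

Lemma mcoeff_kill a (f : mpoly d k) u : mcoeff u (comp_mpoly (kill_vars a) f) =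
  if [forall i : 'I_d, (i < a)%N ==> (u i == 0%N)] then mcoeff u f else 0.
Proof.
have killX v : comp_mpoly (kill_vars a) (x_ v) =
    if [forall i : 'I_d, (i < a)%N ==> (v i == 0%N)] then x_ v else 0.
  rewrite comp_mpolyX; case: ifP => [/forallP H|/negbT].
    rewrite mpolyXE_id; apply: eq_bigr => i _; rewrite tnth_mktuple.
    by case: ifP => // ia; have := H i; rewrite ia /= => /eqP ->; rewrite !expr0.
  rewrite negb_forall => /existsP[i]; rewrite negb_imply => /andP[ia vi].
  by rewrite (bigD1 i) //= tnth_mktuple ia expr0n (negPf vi) mul0r.
rewrite comp_mpolyEX raddf_sum /=.
rewrite (eq_bigr (fun v => if [forall i : 'I_d, (i < a)%N ==> (u i == 0%N)] then
   mcoeff u (mcoeff v f *: x_ v) else 0)); last first.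
  move=> v _; rewrite killX !mcoeffZ mcoeffX.
  case: (eqVneq v u) => [->|vu].
    by case: ifP; rewrite ?mcoeffX ?eqxx ?mcoeff0 ?mulr0.
  by rewrite !mulr0; case: ifP; rewrite ?mcoeffX ?(negPf vu) ?mcoeff0 ?mulr0 // if_same.
case: ifP => _; last by rewrite big1.
by rewrite [in RHS](mpolyE f) raddf_sum.
Qed.

(* The face [x_0 = ... = x_(a-1) = 0], intersected with [t = 0] when [b] holds. *)
Definition face a (b : bool) (w : expo) : bool :=
  [forall i : 'I_d, (i < a)%N ==> (w.1 i == 0%N)] && (b ==> (w.2 == 0%N)).

Definition face_pred a b : {pred RR} :=
  [pred f | `[< forall w, face a b w -> rcoef f w = 0 >]].

(** Restriction to a face: some variables, and [t] when [b] holds, are set to zero. Its target is a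
    domain and its kernel is the face ideal, which makes that ideal prime. *)
Definition face_quot a (b : bool) (f : RR) : {poly mpoly d k} :=
  let g := map_poly (comp_mpoly (kill_vars a)) (rees_poly f) in
  if b then (g`_0)%:P else g.

Lemma face_quotM a b f g : face_quot a b (f * g) = face_quot a b f * face_quot a b g.
Proof. by rewrite /face_quot !rmorphM /=; case: b; rewrite // coef0M polyCM. Qed.

Lemma mem_face a b f : (f \in face_pred a b) = (face_quot a b f == 0).
Proof.
have E w : mcoeff w.1 (face_quot a b f)`_w.2 = if face a b w then rcoef f w else 0.
  rewrite /face_quot /face /rcoef; case: b => /=.
    rewrite coefC coef_map /=; case: (eqVneq w.2 0%N) => [->|_]; last by rewrite mcoeff0 andbF.
    by rewrite mcoeff_kill andbT.
  by rewrite coef_map /= mcoeff_kill andbT.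
apply/asboolP/eqP => [H|H w wf].
  apply/polyP => j; apply/mpolyP => u; rewrite coef0 mcoeff0.
  rewrite [LHS](E (u, j)); case: ifP => // wf; exact: H.
by have := E w; rewrite H coef0 mcoeff0 wf.
Qed.

Lemma face_idealr a b : idealr_closed (face_pred a b).
Proof.
split; first by apply/asboolP => w _; rewrite /rcoef rmorph0 coef0 mcoeff0.
  apply/negP => /asboolP/(_ (mnm0, 0%N)).
  rewrite /rcoef rmorph1 coef1 mcoeff1 eqxx => H.
  have fc : face a b (mnm0, 0%N).
    by rewrite /face /= implybT andbT; apply/forallP => i; rewrite mnm0E eqxx implybT.
  by move/eqP: (H fc); rewrite oner_eq0.
move=> x f g; rewrite mem_face => /eqP f0 /asboolP g0.
have /asboolP h0 : x * f \in face_pred a b by rewrite mem_face face_quotM f0 mulr0.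
by apply/asboolP => w wf; rewrite rcoefD h0 // g0 // addr0.
Qed.

Lemma face_prime a b : prime_idealr_closed (face_pred a b).
Proof. by move=> f g; rewrite !mem_face face_quotM mulf_eq0. Qed.

Definition face_ideal a b : prime_idealr RR :=
  HB.pack_for (prime_idealr RR) (face_pred a b)
    (isIdealr.Build _ (face_pred a b) (face_idealr a b))
    (isPrimeIdealrClosed.Build _ (face_pred a b) (@face_prime a b)).

Lemma face_ideal_sub a b a' b' : (a <= a')%N -> (b ==> b') ->
  {subset face_ideal a b <= face_ideal a' b'}.
Proof.
move=> aa' bb' f /asboolP fa; apply/asboolP => w /andP[/forallP wa wb]; apply: fa.
apply/andP; split; last by case: (b) bb' wb => //= ->.
apply/forallP => i; apply/implyP => ia; have := wa i.
by rewrite (leq_trans ia aa').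
Qed.

Lemma rees_prime_chain : prime_chain (localization M) d.+1.
Proof.
(* The steps [i < d - 1] kill one variable each, step [d - 1] kills [t], and step [d] kills the last
   variable. Here [t] must go before that variable, since on the face [x = 0] the cone contains no
   power of [t]. *)
pose a i := if (i <= d)%N then minn i d.-1 else d.
have ld i : (minn i d.-1 < d)%N by move: d_gt0; lia.
pose l i : 'I_d := Ordinal (ld i).
pose u i := mnm_muln (mnm1 (l i)) c.
have uE i (j : 'I_d) : u i j = ((l i == j) * c)%N by rewrite /u mulmnE mnm1E.
apply: (@localization_prime_chain _ _ (fun i => face_ideal (a i) (d <= i)%N)).
  move=> i f /asboolP fa; rewrite rees_max_coef fa // /face /= implybT andbT.
  by apply/forallP => j; rewrite mnm0E eqxx implybT.
move=> i lid; have lid' : (i <= d)%N by rewrite -ltnS.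
split.
  apply: face_ideal_sub; last by apply/implyP => /leqW.
  rewrite /a lid'; case: ifP => _; first by rewrite leq_min geq_minr andbT geq_min leqnSn.
  by rewrite geq_min leq_pred orbT.
(* The monomial [x_l^c], times [t] at the step that kills [t], lies on the [i]-th face but not on
   the next one. *)
have wc : cone c (u i, (i == d.-1 : nat)).
  rewrite /cone /= mdegMn mdeg1 mul1n dvdnn /= -[leqRHS]muln1 leq_mul2l.
  by case: (i == _); rewrite orbT.
have [X /= XE] := rees_monomial k c_gt0 wc.
have XE' := rcoef_monomial XE.
move=> sub.
have /sub/asboolP/(_ (u i, (i == d.-1 : nat))) :
    X \in face_ideal (a i.+1) (d <= i.+1)%N.
  apply/asboolP => w /andP[/forallP wa wb]; rewrite XE'; case: eqP => // wE.
  move: wa wb; rewrite wE /=; case: (ltngtP i d.-1) => [lt|gt|->] wa wb.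
  - have := wa (l i); rewrite uE eqxx mul1n (gtn_eqF c_gt0) implybF /a.
    by move: lt; rewrite /l /=; case: ifP; lia.
  - have := wa (l i); rewrite uE eqxx mul1n (gtn_eqF c_gt0) implybF /a.
    by move: gt; rewrite /l /=; case: ifP; lia.
  - by move: wb; rewrite prednK // leqnn.
suff fc : face (a i) (d <= i)%N (u i, (i == d.-1 : nat)).
  by move=> /(_ fc)/eqP; rewrite XE' eqxx oner_eq0.
apply/andP; split=> /=; last first.
  by apply/implyP => di; rewrite eqb0 neq_ltn; apply/orP; right; lia.
apply/forallP => j; apply/implyP; rewrite uE; case: (eqVneq (l i) j) => // <-.
by rewrite /a lid' /= ltnn.
Qed.

Lemma rees_krull_dim : has_krull_dim (localization M) d.+1.
Proof. split; [exact: rees_prime_chain|exact: rees_prime_chain_le]. Qed.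

End KrullDimension.

(** * Lengths as numbers of standard monomials *)

Section StandardMonomials.
Variables (k : fieldType) (d c : nat) (c_gt0 : (0 < c)%N).
Local Notation A := (veronese k d c).
Local Notation m := (veronese_max k d c).
Local Notation RR := (rees m).
Local Notation x_ u := (mpolyX k u).
Local Notation expo := (multinom d * nat)%type.
Local Notation M := (veronese_rees_prime k d c_gt0).

(* The box [0, cn)^d contains every u in N^d with |u| < cn. *)
Definition veronese_count n : nat :=
  (\sum_(f : {ffun 'I_d -> 'I_(c * n)%N} | (c %| \sum_i f i) && (\sum_i f i < c * n)) 1)%N.

Lemma veronese_length n : has_length (quot_mod (ideal_exp m n)) (veronese_count n).
Proof.
pose L := [seq box_mnm f | f <- enum [pred f : {ffun 'I_d -> 'I_(c * n)%N} |
  (c %| \sum_i f i)%N && (\sum_i f i < c * n)%N]].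
have memL u : (u \in L) = (c %| mdeg u)%N && (mdeg u < c * n)%N.
  apply/mapP/andP => [[f fP ->]|[cu un]].
    by move: fP; rewrite mem_enum inE mdeg_box => /andP[].
  have [f fE] : exists f, u = box_mnm (N := (c * n)%N) f.
    apply: box_mnm_ex => i; apply: leq_ltn_trans un.
    by rewrite mdegE (bigD1 i) //= leq_addr.
  by exists f => //; rewrite mem_enum inE -mdeg_box -fE cu un.
have -> : veronese_count n = size L.
  by rewrite size_map -cardE -sum1_card /veronese_count; apply: eq_bigl => f; rewrite inE.
apply: (@monomial_quot_length k A m _ (@vcoef k d c) (const_veronese d c) (@mdeg d) L).
- exact: vcoefD.
- exact: vcoefC.
- exact: veronese_const_max.
- by rewrite map_inj_uniq ?enum_uniq //; exact: box_mnm_inj.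
- move=> f g w fm; rewrite memL => /andP[_ wn] /mcoeffM_neq0[v [w' [wE fv gw]]].
  have := vcoef_max fm fv; have cw := vcoef_dvd gw.
  rewrite wE mdegD in wn * => vc.
  exists w'; last by rewrite gw andbT; lia.
  by rewrite memL cw; lia.
- move=> w; rewrite memL => /andP[cw _].
  have [|X _ XE] := @veronese_monomial_exp k d c c_gt0 0 w cw.
    by rewrite muln0.
  by exists X => v _; rewrite /vcoef XE mcoeffX eq_sym.
- move=> f; rewrite (mem_veronese_exp c_gt0); split=> H u.
    by rewrite memL => /andP[_]; exact: H.
  move=> un; apply/eqP; apply: contraT => nz; have := H u.
  by rewrite memL (vcoef_dvd nz) un => /(_ isT) e; rewrite e eqxx in nz.
Qed.

(* The number of exponents j such that x^u t^j lies in the cone but not in the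
   ideal of q-th powers, where n = |u| / c and a = sum_i floor(u_i / q). *)
Definition std_t_count q a n : nat := if (a < c)%N then n.+1 else (2 * q - 1 - n)%N.

(** For [a >= c] the conditions [j < q] and [n < j + q] leave the interval from [n - q + 1] to
    [q - 1]; truncated subtraction makes it empty once [n >= 2 q - 1]. *)
Definition std_t q a n : seq nat :=
  if (a < c)%N then iota 0 n.+1 else iota (n - q).+1 (2 * q - 1 - n)%N.

(** The side [2 c q] contains every standard exponent: either [a < c], so that each [u_i < c q], or
    some [j] is left, so that [n < 2 q] and [|u| < 2 c q]. *)
Definition rees_count q : nat :=
  (\sum_(f : {ffun 'I_d -> 'I_(2 * c * q)%N} | c %| \sum_i f i)
    std_t_count q (\sum_i f i %/ q)%N ((\sum_i f i) %/ c))%N.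

Lemma rees_std_list q : (0 < q)%N -> exists L : seq expo,
  [/\ uniq L, size L = rees_count q &
      forall w, (w \in L) = cone c w && ~~ frob_exp c q w].
Proof.
move=> q0.
pose jr (f : {ffun 'I_d -> 'I_(2 * c * q)%N}) :=
  std_t q (\sum_i f i %/ q)%N ((\sum_i f i) %/ c)%N.
pose F := enum [pred f : {ffun 'I_d -> 'I_(2 * c * q)%N} | (c %| \sum_i f i)%N].
have jrP u j : (c %| mdeg u)%N ->
    (j \in std_t q (\sum_i u i %/ q)%N (mdeg u %/ c)%N) = cone c (u, j) && ~~ frob_exp c q (u, j).
  move=> cu; rewrite /cone /frob_exp /= cu /=.
  have {2 3}-> : mdeg u = (c * (mdeg u %/ c)%N)%N by rewrite mulnC divnK.
  rewrite !leq_pmul2l //; set n := (mdeg u %/ c)%N%N.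
  rewrite /std_t; case: (leqP c (\sum_i u i %/ q)%N) => [le|_]; last first.
    by rewrite mem_iota add0n ltnS /= andbT.
  (* [|u| >= q a >= q c]. So [n - q] is a true subtraction, and [j < q] implies the cone condition
     [j <= n]. *)
  have qn : (q <= n)%N.
    rewrite /n leq_divRL // mulnC; apply: leq_trans (leq_mul le (leqnn q)) _.
    rewrite mdegE big_distrl /=; apply: leq_sum => i _; exact: leq_trunc_div.
  by rewrite mem_iota; apply/idP/idP; lia.
exists [seq (box_mnm f, j) | f <- F, j <- jr f]; split.
- apply: allpairs_uniq_dep; first exact: enum_uniq.
    by move=> f _; rewrite /jr /std_t; case: ifP => _; exact: iota_uniq.
  move=> [f j] [g i] _ _ e; move: (congr1 fst e) (congr1 snd e).
  by move=> /= /box_mnm_inj -> ->.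
- rewrite size_allpairs_dep sumnE big_map big_enum /rees_count.
  apply: eq_big => [f|f _]; first by rewrite inE.
  rewrite /jr /std_t /std_t_count; case: ifP => _; exact: size_iota.
- move=> [u j]; apply/allpairsPdep/andP => [[f [i [fF ij [-> ->]]]]|[wc wf]].
    move: fF; rewrite mem_enum inE => cf.
    apply/andP; rewrite -jrP mdeg_box //; move: ij; rewrite /jr.
    by under eq_bigr do rewrite -box_mnmE.
  have cu : (c %| mdeg u)%N by case/andP: wc.
  have jn : j \in std_t q (\sum_i u i %/ q)%N (mdeg u %/ c)%N by rewrite jrP // wc wf.
  have [f fE] : exists f, u = box_mnm (N := (2 * c * q)%N) f.
    apply: box_mnm_ex => i; move: jn; rewrite /std_t; case: ifP => [ac _|_ jn].
      have : (u i %/ q < c)%N by apply: leq_ltn_trans ac; rewrite (bigD1 i) //= leq_addr.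
      rewrite ltn_divLR // => /leq_trans; apply; rewrite leq_mul2r.
      by apply/orP; right; lia.
    have ui : (u i <= mdeg u)%N by rewrite mdegE (bigD1 i) //= leq_addr.
    have lt : (mdeg u %/ c < 2 * q)%N.
      rewrite ltnNge; apply/negP => le; move: jn.
      by have -> : (2 * q - 1 - mdeg u %/ c)%N = 0%N by lia.
    apply: leq_ltn_trans ui _; move: lt; rewrite ltn_divLR //; lia.
  exists f, j; split=> //; last by rewrite fE.
    by rewrite mem_enum inE -mdeg_box -fE cu.
  rewrite /jr; move: jn; rewrite fE mdeg_box.
  by under eq_bigr do rewrite box_mnmE.
Qed.

Lemma rees_length p e : p \in [pchar k] ->
  has_length (quot_mod (frobenius_power (loc_max M) (p ^ e))) (rees_count (p ^ e)).
Proof.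
move=> pc; have q0 : (0 < p ^ e)%N by rewrite expn_gt0 prime_gt0 // (pcharf_prime pc).
have [L [Lu <- memL]] := rees_std_list q0.
apply: (@monomial_localization_length k RR (rees_max m) _ (@rcoef k d c)
  (* The degree in [x] alone can order the series, because every exponent occurring in [M] has
     [|u| >= c > 0]. *)
  (rees_scalar d c) (fun w => mdeg w.1) L _ _ _ Lu _ _ M
  (frobenius_power (rees_max m) (p ^ e))).
- exact: rcoefD.
- exact: rcoefC.
- exact: rees_decomp.
- move=> f g w fM; rewrite memL => /andP[_ wF] /rcoefM_neq0[v [w' [wE fv gw]]].
  have vc := rcoef_max c_gt0 fM fv; exists w'.
    rewrite memL (rcoef_cone gw) /=; apply: contra wF => w'F; rewrite wE.
    by apply: frob_exp_add => //; exact: rcoef_cone fv.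
  by rewrite gw andbT wE /= mdegD; lia.
- move=> w; rewrite memL => /andP[wc _].
  have [X XE] := rees_monomial k c_gt0 wc.
  by exists X => v _; rewrite [w]surjective_pairing; exact: rcoef_monomial.
- by [].
- move=> f; rewrite (mem_frobenius_rees c_gt0 pc); split=> [H w|H w wc wF].
    by rewrite memL => /andP[]; exact: H.
  by apply: H; rewrite memL wc wF.
- by move=> sat f s; exact: mem_frobenius_loc_max.
Qed.

End StandardMonomials.

(** * Sums over boxes, binomial identities, averaging over a congruence *)

Section BoxSums.
Local Open Scope nat_scope.

(* The sum of F(|u|) over the u in [0, N)^d. *)
Fixpoint box_sum d N (F : nat -> nat) : nat :=
  if d is d'.+1 then \sum_(x < N) box_sum d' N (fun m => F (x + m)) else F 0.

Lemma eq_box_sum d N F G : (forall m, m <= d * N -> F m = G m) ->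
  box_sum d N F = box_sum d N G.
Proof.
elim: d F G => [|d IH] F G H /=; first exact: H.
apply: eq_bigr => x _; apply: IH => m le; apply: H.
by rewrite mulSn leq_add // ltnW.
Qed.

Lemma leq_box_sum d N F G : (forall m, m <= d * N -> F m <= G m) ->
  box_sum d N F <= box_sum d N G.
Proof.
elim: d F G => [|d IH] F G H /=; first exact: H.
apply: leq_sum => x _; apply: IH => m le; apply: H.
by rewrite mulSn leq_add // ltnW.
Qed.

Lemma box_sumD d N F G :
  box_sum d N (fun m => F m + G m) = box_sum d N F + box_sum d N G.
Proof.
elim: d F G => [//|d IH] F G /=; rewrite -big_split; apply: eq_bigr => x _ /=.
by rewrite IH.
Qed.

Lemma box_sumM d N a F : box_sum d N (fun m => a * F m) = a * box_sum d N F.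
Proof.
elim: d F => [//|d IH] F /=; rewrite big_distrr; apply: eq_bigr => x _ /=.
by rewrite IH.
Qed.

Lemma box_sum_const d N a : box_sum d N (fun=> a) = N ^ d * a.
Proof.
elim: d => [|d IH] /=; first by rewrite mul1n.
by rewrite (eq_bigr _ (fun _ _ => IH)) sum_nat_const card_ord expnS mulnA.
Qed.

Lemma box_sum_sum d N n (F : nat -> nat -> nat) :
  box_sum d N (fun m => \sum_(x < n) F x m) = \sum_(x < n) box_sum d N (F x).
Proof.
elim: d F => [//|d IH] F /=; rewrite exchange_big; apply: eq_bigr => y _ /=.
by rewrite (IH (fun x m => F x (y + m))).
Qed.

Lemma sum_quot_rem M q (H : nat -> nat) :
  \sum_(x < M * q) H x = \sum_(a < M) \sum_(r < q) H (q * a + r).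
Proof.
elim: M => [|M IH]; first by rewrite mul0n !big_ord0.
rewrite big_ord_recr -IH mulSnr big_split_ord /=; congr (_ + _).
by apply: eq_bigr => r _; rewrite [q * M]mulnC.
Qed.

Definition ffun_cons (T : Type) d (x : T) (g : {ffun 'I_d -> T}) : {ffun 'I_d.+1 -> T} :=
  [ffun i => if unlift ord0 i is Some j then g j else x].

Lemma sum_ffun_recl d N (H : {ffun 'I_d.+1 -> 'I_N} -> nat) :
  \sum_f H f = \sum_x \sum_g H (ffun_cons x g).
Proof.
rewrite pair_big /=; apply: (reindex (fun p => ffun_cons p.1 p.2)).
exists (fun f : {ffun 'I_d.+1 -> 'I_N} =>
  (f ord0, [ffun j : 'I_d => f (lift ord0 j)])) => [[x g] _|f _] /=.
  rewrite ffunE unlift_none; congr (_, _); apply/ffunP => j.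
  by rewrite !ffunE liftK.
by apply/ffunP => i; rewrite ffunE; case: unliftP => [j|] ->; rewrite ?ffunE.
Qed.

Lemma sum_ffun_cons d N (psi : nat -> nat) (x : 'I_N) (g : {ffun 'I_d -> 'I_N}) :
  \sum_i psi (ffun_cons x g i) = psi x + \sum_i psi (g i).
Proof.
rewrite big_ord_recl ffunE unlift_none; congr (_ + _).
by apply: eq_bigr => i _; rewrite ffunE liftK.
Qed.

Lemma sum_ffun_box d N (G : nat -> nat) :
  \sum_(f : {ffun 'I_d -> 'I_N}) G (\sum_i f i) = box_sum d N G.
Proof.
elim: d G => [|d IH] G.
  rewrite (eq_bigr (fun=> G 0)) => [|f _]; last by rewrite big_ord0.
  by rewrite sum_nat_const card_ffun !card_ord expn0 mul1n.
rewrite sum_ffun_recl /=; apply: eq_bigr => x _.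
rewrite -(IH (fun m => G (x + m))); apply: eq_bigr => g _.
by rewrite (sum_ffun_cons id).
Qed.

(** Division with remainder [u = q a + r] in each coordinate: the summand sees only [|a|] and
    [|u| = q |a| + |r|], so cells and remainders separate. *)
Lemma sum_ffun_cells d M q (G : nat -> nat -> nat) : 0 < q ->
  \sum_(f : {ffun 'I_d -> 'I_(M * q)}) G (\sum_i f i %/ q) (\sum_i f i) =
  box_sum d M (fun s => box_sum d q (fun m => G s (q * s + m))).
Proof.
move=> q0; elim: d G => [|d IH] G.
  rewrite (eq_bigr (fun=> G 0 0)) => [|f _]; last by rewrite !big_ord0.
  by rewrite sum_nat_const card_ffun !card_ord expn0 mul1n /= muln0.
rewrite sum_ffun_recl.
transitivity (\sum_(x < M * q) box_sum d M (fun s => box_sum d q (fun m =>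
    G (x %/ q + s) (x + (q * s + m))))).
  apply: eq_bigr => x _; rewrite -(IH (fun s m => G (x %/ q + s) (x + m))).
  apply: eq_bigr => g _.
  by rewrite (sum_ffun_cons (fun y => y %/ q)) (sum_ffun_cons id).
rewrite (sum_quot_rem M q (fun x => box_sum d M (fun s => box_sum d q (fun m =>
    G (x %/ q + s) (x + (q * s + m)))))) /=.
apply: eq_bigr => a _.
rewrite -(box_sum_sum d M q (fun r s => box_sum d q (fun m =>
    G ((q * a + r) %/ q + s) (q * a + r + (q * s + m))))).
apply: eq_box_sum => s _; apply: eq_bigr => r _; apply: eq_box_sum => m _.
rewrite mulnC divnMDl // divn_small // addn0; congr (G _ _).
by rewrite mulnDr [a * q]mulnC; lia.
Qed.

Lemma box_sum_cells d M q F : 0 < q ->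
  box_sum d (M * q) F = box_sum d M (fun a => box_sum d q (fun r => F (q * a + r))).
Proof.
by move=> q0; rewrite -sum_ffun_box (sum_ffun_cells d M (fun _ m => F m) q0).
Qed.

Lemma sum_bin_tail n k N : n <= N ->
  \sum_(x < N) 'C(n - x + k, k.+1) = 'C(n + k.+1, k.+2).
Proof.
move=> nN; rewrite -(subnKC nN) big_split_ord /= [X in _ + X]big1 => [|i _]; last first.
  by rewrite subnDA subnn bin_small.
rewrite addn0; elim: n {nN} => [|n IH]; first by rewrite big_ord0 bin_small.
rewrite big_ord_recl subn0 /=.
under eq_bigr do rewrite /bump add1n subSS.
by rewrite IH [n.+1 + k.+1]addSn binS addnC addSnnS.
Qed.

Lemma box_sum_bin d n k N : n <= N ->
  box_sum d N (fun t => 'C(n - t + k, k.+1)) = 'C(n + (k + d), (k + d).+1).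
Proof.
elim: d n => [|d IH] n nN; first by rewrite /= subn0 addn0.
rewrite /= addnS -(sum_bin_tail (k + d) nN); apply: eq_bigr => x _.
rewrite -IH; last exact: leq_trans (leq_subr _ _) nN.
by apply: eq_box_sum => t _; rewrite subnDA.
Qed.

(** The indicator is the difference of the truncated [n + 1 - t] and [n - t], and Pascal's rule
    subtracts their sums. *)
Lemma box_sum_lt d n N : n < N -> box_sum d N (fun t => t < n.+1) = 'C(n + d, d).
Proof.
move=> nN; apply: (@addnI (box_sum d N (fun t => 'C(n - t + 0, 1)))).
rewrite -box_sumD box_sum_bin ?(ltnW nN) // add0n -binS.
transitivity (box_sum d N (fun t => 'C(n.+1 - t + 0, 1))).
  by apply: eq_box_sum => m _; rewrite !addn0 !bin1; lia.
by rewrite box_sum_bin // add0n.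
Qed.

Definition close e a b : bool := (a <= b + e) && (b <= a + e).

Lemma close_sum n e (F G : nat -> nat) : (forall x, x < n -> close e (F x) (G x)) ->
  close (n * e) (\sum_(x < n) F x) (\sum_(x < n) G x).
Proof.
move=> H; have E : n * e = \sum_(x < n) e by rewrite sum_nat_const card_ord.
by apply/andP; rewrite E -!big_split; split; apply: leq_sum => x _;
  have /andP[] := H x (ltn_ord x).
Qed.

Lemma close_box_sum d N e F G : (forall m, m <= d * N -> close e (F m) (G m)) ->
  close (N ^ d * e) (box_sum d N F) (box_sum d N G).
Proof.
elim: d F G => [|d IH] F G H /=; first by rewrite mul1n; exact: H.
rewrite expnS -mulnA; apply: (@close_sum _ _ (fun x => box_sum d N (fun m => F (x + m)))
   (fun x => box_sum d N (fun m => G (x + m)))) => x xN.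
by apply: IH => m le; apply: H; rewrite mulSn leq_add // ltnW.
Qed.

Lemma close_trans e1 e2 a b c : close e1 a b -> close e2 b c -> close (e1 + e2) a c.
Proof. by rewrite /close; lia. Qed.

Lemma closeM x e a b : close e a b -> close (x * e) (x * a) (x * b).
Proof.
by move=> /andP[H1 H2]; apply/andP; rewrite -!mulnDr !leq_mul2l H1 H2 !orbT.
Qed.

Lemma close_le e e' a b : e <= e' -> close e a b -> close e' a b.
Proof. by rewrite /close; lia. Qed.

Definition monotone (W : nat -> nat) : Prop :=
  (forall m, W m <= W m.+1) \/ (forall m, W m.+1 <= W m).

Section Averaging.
Variables (c : nat) (c_gt0 : 0 < c).

(* [c [c | y] - 1 = gamma y - gamma (y + 1)] *)
Let gamma y := (y + c.-1) %% c.

Let gammaS y : gamma y.+1 = y %% c.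
Proof. by rewrite /gamma addSnnS prednK // modnDr. Qed.

Let gamma_dvd y : gamma y + 1 = gamma y.+1 + c * (c %| y).
Proof.
rewrite gammaS /gamma {1}(divn_eq y c) -addnA modnMDl /dvdn.
case: (posnP (y %% c)) => [->|r0].
  by rewrite add0n modn_small ?muln1 ?add0n ?prednK // addn1 prednK.
rewrite muln0 addn0.
have -> : y %% c + c.-1 = (y %% c).-1 + c by lia.
rewrite modnDr modn_small; first by rewrite addn1 prednK.
by apply: leq_ltn_trans (ltn_pmod y c_gt0); exact: leq_pred.
Qed.

Let gamma_lt y : gamma y < c.
Proof. exact: ltn_pmod. Qed.

(** Abel summation with [gamma], which takes values in [[0, c)]. The boundary terms contribute at
    most [c B], and so do the increments of [W], because they all have the same sign. *)
Lemma average_sum t n W B : monotone W -> (forall x, x <= n -> W x <= B) ->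
  close (2 * c * B) (c * \sum_(x < n) (c %| t + x) * W x) (\sum_(x < n) W x).
Proof.
move=> Wmono WB; rewrite big_distrr /=.
have [W0 Wn] := (WB 0 (leq0n _), WB n (leqnn _)).
pose A k := \sum_(x < k) W x; pose D k := \sum_(x < k) c * ((c %| t + x) * W x).
change (close (2 * c * B) (D n) (A n)).
have AS k : A k.+1 = A k + W k by rewrite /A big_ord_recr.
have DS k : D k.+1 = D k + c * (c %| t + k) * W k.
  by rewrite /D big_ord_recr /= mulnA.
have D0 : D 0 = 0 by rewrite /D big_ord0.
have A0 : A 0 = 0 by rewrite /A big_ord0.
have step k : D k.+1 + gamma (t + k.+1) * W k = D k + gamma (t + k) * W k + W k.
  rewrite DS addnS -addnA -mulnDl [c * _ + _]addnC -gamma_dvd.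
  by rewrite mulnDl mul1n addnA.
have bnd y x : x <= n -> gamma y * W x <= c * B.
  by move=> xn; rewrite leq_mul ?WB // ltnW.
have cW x : x <= n -> c * W x <= c * B by move=> xn; rewrite leq_mul2l WB ?orbT.
have [cW0 cWn] := (cW 0 (leq0n _), cW n (leqnn _)).
have [g0 gn] := (bnd t 0 (leq0n _), bnd (t + n) n (leqnn _)).
case: Wmono => Wmono.
  (* In other words, the excess of [D k + gamma (t + k) W k] over [A k + gamma t W 0] lies between
     [0] and [c (W k - W 0)]; the decreasing case below reverses the signs. *)
  have H k : D k + gamma (t + k) * W k + c * W 0 <= A k + gamma t * W 0 + c * W k /\
             A k + gamma t * W 0 <= D k + gamma (t + k) * W k.
    elim: k => [|k [IH1 IH2]]; first by rewrite D0 A0 addn0.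
    have p1 : gamma (t + k.+1) * W k <= gamma (t + k.+1) * W k.+1.
      by rewrite leq_mul2l Wmono orbT.
    have p2 : gamma (t + k.+1) * W k.+1 + c * W k <= gamma (t + k.+1) * W k + c * W k.+1.
      by have := Wmono k; have := gamma_lt (t + k.+1); nia.
    by have := step k; have := AS k; lia.
  by have [H1 H2] := H n; rewrite /close; lia.
have H k : D k + gamma (t + k) * W k <= A k + gamma t * W 0 /\
           A k + gamma t * W 0 + c * W k <= D k + gamma (t + k) * W k + c * W 0.
  elim: k => [|k [IH1 IH2]]; first by rewrite D0 A0 addn0.
  have p1 : gamma (t + k.+1) * W k.+1 <= gamma (t + k.+1) * W k.
    by rewrite leq_mul2l Wmono orbT.
  have p2 : gamma (t + k.+1) * W k + c * W k.+1 <= gamma (t + k.+1) * W k.+1 + c * W k.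
    by have := Wmono k; have := gamma_lt (t + k.+1); nia.
  by have := step k; have := AS k; lia.
by have [H1 H2] := H n; rewrite /close; lia.
Qed.

(** One coordinate is averaged with the others fixed; each of the [d] remaining coordinates
    multiplies the error by [N], against [N^(d+1)] terms in the sum. *)
Lemma average_box_sum d N t W B : monotone W ->
  (forall m, m <= t + d.+1 * N -> W m <= B) ->
  close (N ^ d * (2 * c * B)) (c * box_sum d.+1 N (fun m => (c %| t + m) * W (t + m)))
    (box_sum d.+1 N (fun m => W (t + m))).
Proof.
move=> Wmono; elim: d t => [|d IH] t WB.
  rewrite mul1n /=; under eq_bigr do rewrite addn0.
  under [in X in close _ _ X]eq_bigr do rewrite addn0.
  apply: (@average_sum t N (fun x => W (t + x))).
    by case: Wmono => H; [left|right] => m; rewrite addnS.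
  by move=> x xN; apply: WB; rewrite mul1n leq_add2l.
rewrite [box_sum d.+2 N _]/= [X in close _ _ X]/= big_distrr expnS -mulnA.
apply: (@close_sum _ _ (fun x => c * box_sum d.+1 N (fun m => (c %| t + (x + m)) * W (t + (x + m))))
   (fun x => box_sum d.+1 N (fun m => W (t + (x + m))))) => x xN.
have -> : box_sum d.+1 N (fun m => W (t + (x + m))) = box_sum d.+1 N (fun m => W (t + x + m)).
  by apply: eq_box_sum => m _; rewrite addnA.
have -> : box_sum d.+1 N (fun m => (c %| t + (x + m)) * W (t + (x + m))) =
          box_sum d.+1 N (fun m => (c %| t + x + m) * W (t + x + m)).
  by apply: eq_box_sum => m _; rewrite addnA.
apply: IH => m le; apply: WB; apply: leq_trans le _.
by rewrite -addnA leq_add2l [d.+2 * N]mulSn leq_add2r ltnW.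
Qed.

End Averaging.
End BoxSums.

(** * Lengths up to terms of lower order *)

Section LengthEstimates.
Local Open Scope nat_scope.
Variables (d c : nat) (d_gt0 : 0 < d) (c_gt0 : 0 < c).

(* Up to an error of at most c, this is c times the number of j counted by
   [std_t_count], for |u| = m in the cell floor(u / q) of degree s. *)
Definition cell_weight q s m : nat := if s < c then m else 2 * c * q - m.

Definition cell_sum q s : nat := box_sum d q (fun m => cell_weight q s (q * s + m)).

Lemma cell_weight_monotone q s : monotone (cell_weight q s).
Proof.
by rewrite /monotone /cell_weight; case: (s < c); [left|right] => m; lia.
Qed.

Lemma cell_weight_le q s m : cell_weight q s m <= 2 * c * q + m.
Proof.
rewrite /cell_weight; case: ifP => _; first exact: leq_addl.
exact: leq_trans (leq_subr _ _) (leq_addr _ _).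
Qed.

Lemma std_t_count_close q s n : 0 < q ->
  close c (c * std_t_count c q s n) (cell_weight q s (n * c)).
Proof.
move=> q0; rewrite /std_t_count /cell_weight; case: ifP => _.
  by rewrite /close mulnS [n * c]mulnC; lia.
rewrite !mulnBr muln1 -mulnA [2 * (c * q)]mulnCA [n * c]mulnC /close; lia.
Qed.

(** One factor [c] turns the number of [j] into [cell_weight], the other compensates the density
    [1/c] of the congruence. The two summands of [K] are the errors of these two replacements; in
    the second, weights are at most [(2 c + 2 c d + d) q]. *)
Lemma rees_count_close : exists K, forall q, 0 < q ->
  close (K * q ^ d) (c ^ 2 * rees_count d c q)
    (box_sum d (2 * c) (fun s => cell_sum q s)).
Proof.
exists (c * ((2 * c) ^ d * c) + (2 * c) ^ d * (2 * c * (2 * c + d * (2 * c) + d))).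
move=> q q0; pose S := box_sum d (2 * c) (fun s => box_sum d q (fun m =>
  (c %| q * s + m) * cell_weight q s (q * s + m))).
have cE : rees_count d c q = box_sum d (2 * c) (fun s => box_sum d q (fun m =>
    (c %| q * s + m) * std_t_count c q s ((q * s + m) %/ c))).
  rewrite -(@sum_ffun_cells d (2 * c) q (fun s m => (c %| m) * std_t_count c q s (m %/ c)) q0).
  by rewrite /rees_count big_mkcond /=; apply: eq_bigr => f _; case: (c %| _); rewrite ?mul1n.
rewrite mulnDl; apply: (@close_trans _ _ _ (c * S)).
  rewrite -mulnn -!mulnA; apply: closeM; rewrite cE -box_sumM.
  apply: (@close_le ((2 * c) ^ d * (q ^ d * c))); first by rewrite [q ^ d * c]mulnC.
  apply: close_box_sum => s _; rewrite -box_sumM; apply: close_box_sum => m _.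
  case: (boolP (c %| q * s + m)) => [/divnK cm|_]; last by rewrite /close muln0.
  by rewrite !mul1n -{2}cm; exact: std_t_count_close.
rewrite /S -box_sumM.
apply: (@close_le ((2 * c) ^ d * (q ^ d.-1 * (2 * c * ((2 * c + d * (2 * c) + d) * q))))).
  have -> : q ^ d = q * q ^ d.-1 by rewrite -expnS prednK.
  by move: ((2 * c) ^ d) (q ^ d.-1) (2 * c + d * (2 * c) + d) => x y z; nia.
apply: close_box_sum => s sle; rewrite /cell_sum -[X in box_sum X q](prednK d_gt0).
rewrite -[in X in close _ _ X](prednK d_gt0) /=.
apply: (average_box_sum c_gt0 (cell_weight_monotone q s)) => m.
rewrite prednK // => le; apply: leq_trans (cell_weight_le _ _ _) _.
have sq : q * s <= d * (2 * c) * q by rewrite mulnC leq_mul2r sle orbT.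
by rewrite !mulnDl; lia.
Qed.

(** Averaging with the indicator of [|u| < c n], which is decreasing and bounded by [B = 1]. *)
Lemma veronese_count_close n : 0 < n ->
  close ((c * n) ^ d.-1 * (2 * c)) (c * veronese_count d c n) 'C((c * n).-1 + d, d).
Proof.
move=> n0; have cn0 : 0 < c * n by rewrite muln_gt0 c_gt0.
have E : veronese_count d c n = box_sum d (c * n) (fun t => (c %| t) * (t < (c * n).-1.+1)).
  rewrite /veronese_count big_mkcond /= prednK //.
  rewrite -(@sum_ffun_box d (c * n) (fun t => (c %| t) * (t < c * n))).
  by apply: eq_bigr => f _; case: (c %| _); case: (_ < _).
rewrite E -(@box_sum_lt d _ (c * n)) ?prednK //.
have := @average_box_sum c c_gt0 d.-1 (c * n) 0 (fun t => t < c * n) 1.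
rewrite prednK // muln1 => H; apply: H.
  by right=> m; case: (m.+1 < c * n) (ltnW (n:=c * n) (m:=m.+1)) => // ->.
by move=> m _; case: (_ < _).
Qed.

End LengthEstimates.

(** * Limits of integer sequences divided by powers *)

Section RealLimits.
Variable R : realType.
Implicit Types (u v : nat -> R) (l : R).

Lemma cvg_pow u l k : u @ \oo --> l -> (fun n => u n ^+ k) @ \oo --> l ^+ k.
Proof.
move=> ul; elim: k => [|k IH]; first by rewrite expr0; exact: cvg_cst.
rewrite exprS; under eq_fun do rewrite exprS; exact: cvgM.
Qed.

Lemma cvg_dist u v (w : nat -> R) l : (forall n, `|u n - v n| <= w n) ->
  w @ \oo --> 0 -> v @ \oo --> l -> u @ \oo --> l.
Proof.
move=> uvw w0 vl; have d0 : (fun n => u n - v n) @ \oo --> 0.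
  apply: norm_cvg0; apply: (@squeeze_cvgr _ _ _ _ (fun=> 0) w); last 2 first.
  - exact: cvg_cst.
  - exact: w0.
  by apply: nearW => n; rewrite normr_ge0 uvw.
rewrite -[l]addr0; have -> : u = (fun n => v n + (u n - v n)).
  by apply/funext => n; rewrite addrCA subrr addr0.
exact: cvgD.
Qed.

Definition to_infty (q : nat -> nat) : Prop :=
  (forall n, (0 < q n)%N) /\ (fun n => (q n)%:R^-1 : R) @ \oo --> 0.

Lemma to_inftyM q a : (0 < a)%N -> to_infty q -> to_infty (fun n => a * q n)%N.
Proof.
move=> a0 [q0 qV]; split=> [n|]; first by rewrite muln_gt0 a0 q0.
under eq_fun do rewrite natrM invfM; rewrite -[0](mulr0 (a%:R^-1 : R)).
by apply: cvgM => //; exact: cvg_cst.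
Qed.

Lemma to_infty_exp p : (1 < p)%N -> to_infty (fun e => p ^ e)%N.
Proof.
move=> p1; have p0 := ltnW p1; split=> [n|]; first by rewrite expn_gt0 p0.
under eq_fun do rewrite natrX -exprVn; apply: cvg_expr.
by rewrite ger0_norm ?invr_ge0 // invf_lt1 ?ltr1n // ltr0n.
Qed.

Lemma to_inftyS : to_infty succn.
Proof. by split=> //; exact: cvg_harmonic. Qed.

Lemma cvg_close (K k : nat) q (a b : nat -> nat) l : to_infty q ->
  (forall n, close (K * q n ^ k) (a n) (b n)) ->
  (fun n => (b n)%:R / (q n ^ k.+1)%:R : R) @ \oo --> l ->
  (fun n => (a n)%:R / (q n ^ k.+1)%:R : R) @ \oo --> l.
Proof.
move=> [q0 qV] ab; apply: (@cvg_dist _ _ (fun n => K%:R * (q n)%:R^-1)).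
  move=> n; have qk : (0 : R) < (q n ^ k.+1)%:R by rewrite ltr0n expn_gt0 q0.
  rewrite -mulrBl normrM [X in _ * X]gtr0_norm ?invr_gt0 // ler_pdivrMr //.
  rewrite expnS natrM mulrA divfK ?pnatr_eq0 -?lt0n // -natrM.
  have /andP[H1 H2] := ab n.
  by rewrite ler_distl lerBlDr -!natrD !ler_nat H1 H2.
by rewrite -(mulr0 (K%:R : R)); apply: cvgM => //; exact: cvg_cst.
Qed.

Lemma leq_ffact_pow N k : (N ^ k.+1 <= (N + k) ^_ k.+1 <= (N + k) ^ k.+1)%N.
Proof.
elim: k => [|k /andP[IH1 IH2]]; first by rewrite addn0 !ffactn1 expn1 leqnn.
rewrite addnS ffactSS expnS [((N + k).+1 ^ _)%N]expnS; apply/andP; split.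
  by apply: leq_mul => //; apply: leq_trans (leq_addr k N) _.
by rewrite leq_mul2l (leq_trans IH2) ?orbT // leq_exp2r.
Qed.

(** The falling factorial divided by [q^(k+1)] is squeezed between [1] and [(1 + k/q)^(k+1)]. *)
Lemma cvg_bin q k : to_infty q ->
  (fun n => 'C(q n + k, k.+1)%:R / (q n ^ k.+1)%:R : R) @ \oo --> (k.+1`!%:R^-1 : R).
Proof.
move=> [q0 qV].
have fE n : 'C(q n + k, k.+1)%:R / (q n ^ k.+1)%:R =
    (((q n + k) ^_ k.+1)%:R / (q n ^ k.+1)%:R) / k.+1`!%:R :> R.
  by rewrite -bin_ffact natrM mulrAC mulfK // pnatr_eq0 -lt0n fact_gt0.
under eq_fun do rewrite fE.
have up : (fun n => (1 + k%:R * (q n)%:R^-1) ^+ k.+1 : R) @ \oo --> (1 : R).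
  have : (fun n => (1 + k%:R * (q n)%:R^-1) ^+ k.+1 : R) @ \oo --> ((1 + k%:R * 0) ^+ k.+1 : R).
    by apply: cvg_pow; apply: cvgD; [exact: cvg_cst|apply: cvgM => //; exact: cvg_cst].
  by rewrite mulr0 addr0 expr1n.
suff lim1 : (fun n => ((q n + k) ^_ k.+1)%:R / (q n ^ k.+1)%:R : R) @ \oo --> (1 : R).
  have := cvgM lim1 (cvg_cst (k.+1`!%:R^-1 : R)); rewrite mul1r; exact.
apply: (squeeze_cvgr _ (cvg_cst (1 : R)) up).
apply: nearW => n; have qn : (0 : R) < (q n)%:R by rewrite ltr0n.
have qk : (0 : R) < (q n ^ k.+1)%:R by rewrite natrX exprn_gt0.
have /andP[H1 H2] := leq_ffact_pow (q n) k.
rewrite ler_pdivlMr // mul1r ler_nat H1 ler_pdivrMr // natrX -exprMn.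
rewrite mulrDl mul1r divfK ?gt_eqF // -natrD -natrX ler_nat.
by rewrite H2.
Qed.

Lemma is_cvg_box_sum (x : nat -> nat -> nat) (Q : nat -> R) d N :
  (forall s, exists l, (fun n => (x n s)%:R / Q n) @ \oo --> l) ->
  exists l, (fun n => (box_sum d N (x n))%:R / Q n) @ \oo --> l.
Proof.
elim: d x => [|d IH] x H /=; first exact: H.
have {}IH j : exists l,
    (fun n => (box_sum d N (fun m => x n (j + m)%N))%:R / Q n) @ \oo --> l.
  by apply: IH => s; exact: H.
suff H' k : exists l, (fun n =>
    (\sum_(j < k) box_sum d N (fun m => x n (j + m)))%N%:R / Q n) @ \oo --> l by exact: H'.
elim: k => [|k [l1 H1]].
  by exists 0; under eq_fun do rewrite big_ord0 mul0r; exact: cvg_cst.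
have [l2 H2] := IH k.
exists (l1 + l2); under eq_fun do rewrite big_ord_recr natrD mulrDl /=.
exact: cvgD.
Qed.

End RealLimits.

(** * Limits of the normalized lengths *)

Section LengthLimits.
Variable R : realType.
Variables (d c : nat) (d_gt0 : (0 < d)%N) (c_gt0 : (0 < c)%N).

(** Each point of the cell is refined into [p^d] points, and its weight scales by [p] up to
    rounding; the sign of the rounding depends only on the side of [c] on which [s] lies. *)
Lemma cell_sumM p q s : (0 < p)%N -> (0 < q)%N ->
  if (s < c)%N then (p ^ d.+1 * cell_sum d c q s <= cell_sum d c (q * p) s)%N
  else (cell_sum d c (q * p) s <= p ^ d.+1 * cell_sum d c q s)%N.
Proof.
move=> p0 q0; rewrite /cell_sum box_sum_cells // -box_sumM.
have cst w : (p ^ d.+1 * w = box_sum d p (fun=> p * w))%N.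
  by rewrite box_sum_const expnSr mulnA.
rewrite /cell_weight; case: ifP => sc;
  apply: leq_box_sum => m _; rewrite cst; apply: leq_box_sum => r _; rewrite sc ?mulnBr; nia.
Qed.

Lemma cell_sum_le q s : (cell_sum d c q s <= (2 * c + s + d) * q ^ d.+1)%N.
Proof.
rewrite mulnC expnSr -mulnA -box_sum_const; apply: leq_box_sum => m le.
by apply: (leq_trans (cell_weight_le c q s _)); nia.
Qed.

Lemma cvg_cell_sum p s : (1 < p)%N -> exists l : R,
  (fun e => (cell_sum d c (p ^ e) s)%:R / ((p ^ e) ^ d.+1)%:R) @ \oo --> l.
Proof.
move=> p1; have p0 := ltnW p1.
set u : nat -> R := fun e => _.
have pos e : (0 : R) < ((p ^ e) ^ d.+1)%:R by rewrite ltr0n !expn_gt0 p0.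
(* Puts [u e] over the denominator of [u e.+1], so that [cell_sumM] compares the numerators. *)
have uS e : u e = (p ^ d.+1 * cell_sum d c (p ^ e) s)%:R / ((p ^ e.+1) ^ d.+1)%:R.
  rewrite [(p ^ e.+1)%N]expnS expnMn !natrM invfM mulrACA divff ?mul1r //.
  by rewrite pnatr_eq0 -lt0n expn_gt0 p0.
have bnd e : 0 <= u e <= (2 * c + s + d)%:R.
  rewrite divr_ge0 ?ler0n //= ler_pdivrMr // -natrM ler_nat; exact: cell_sum_le.
suff : cvgn u by move=> /cvg_ex[l ul]; exists l.
have key e := @cell_sumM p (p ^ e) s p0.
have q0 e : (0 < p ^ e)%N by rewrite expn_gt0 p0.
case: (s < c)%N key => key.
- apply: nondecreasing_is_cvgn.
    apply/nondecreasing_seqP => e; rewrite uS ler_pM2r ?invr_gt0 // ler_nat.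
    by rewrite [(p ^ e.+1)%N]expnSr; exact: (key e (q0 e)).
  by exists (2 * c + s + d)%:R => _ [e _ <-]; case/andP: (bnd e).
- apply: nonincreasing_is_cvgn.
    apply/nonincreasing_seqP => e; rewrite [leRHS]uS ler_pM2r ?invr_gt0 // ler_nat.
    by rewrite [(p ^ e.+1)%N]expnSr; exact: (key e (q0 e)).
  by exists 0 => _ [e _ <-]; case/andP: (bnd e).
Qed.

Lemma cvg_rees_count (q : nat -> nat) (l : R) : to_infty R q ->
  (fun e => (box_sum d (2 * c) (cell_sum d c (q e)))%:R / (q e ^ d.+1)%:R) @ \oo --> l ->
  (fun e => (rees_count d c (q e))%:R / (q e ^ d.+1)%:R) @ \oo --> l / c%:R ^+ 2.
Proof.
move=> qi ul; have [K HK] := rees_count_close d_gt0 c_gt0.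
have H := cvg_close qi (fun e => HK (q e) (qi.1 e)) ul.
have -> : (fun e => (rees_count d c (q e))%:R / (q e ^ d.+1)%:R) =
  (fun e => (c ^ 2 * rees_count d c (q e))%:R / (q e ^ d.+1)%:R / c%:R ^+ 2) :> (nat -> R).
  apply/funext => e; rewrite natrM (natrX _ c 2) [RHS]mulrAC [c%:R ^+ 2 * _]mulrC mulfK //.
  by rewrite expf_neq0 // pnatr_eq0 -lt0n.
by apply: cvgM => //; exact: cvg_cst.
Qed.

Lemma rees_count_is_cvg p : (1 < p)%N -> exists l : R,
  (fun e => (rees_count d c (p ^ e))%:R / ((p ^ e) ^ d.+1)%:R) @ \oo --> l.
Proof.
move=> p1; have [l H] := is_cvg_box_sum d (2 * c) (fun s => cvg_cell_sum s p1).
by exists (l / c%:R ^+ 2); apply: cvg_rees_count H; exact: to_infty_exp.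
Qed.

(** Each of the [d] coordinates has mean [(q - 1)/2]; the halving and the subtraction are
    cleared. *)
Lemma box_sum_id q : (2 * box_sum d q id + d * q ^ d = d * q ^ d * q)%N.
Proof.
clear d_gt0; elim: d => [|d' IH]; first by rewrite !mul0n.
have -> : box_sum d'.+1 q id = (q ^ d' * (\sum_(x < q) x) + q * box_sum d' q id)%N.
  rewrite /= (eq_bigr (fun x : 'I_q => q ^ d' * x + box_sum d' q id)%N).
    by rewrite big_split -big_distrr /= sum_nat_const card_ord.
  by move=> x _; rewrite box_sumD box_sum_const.
have T : (2 * (\sum_(x < q) x) + q = q * q)%N.
  elim: (q) => [|k IHk]; first by rewrite big_ord0.
  rewrite big_ord_recr /=; move: (\sum_(i < k) i)%N IHk => S; clear; nia.
have := congr1 (muln (q ^ d')) T; have := congr1 (muln q) IH.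
by rewrite !expnS; move: (q ^ d')%N (\sum_(x < q) x)%N (box_sum d' q id); nia.
Qed.

(* For [d <= c + 1] no cell [s < c] meets the truncation of [2 c q - m]. *)
Lemma cell_sum_value q : (0 < q)%N -> (d <= c.+1)%N ->
  (box_sum d (2 * c) (cell_sum d c q) + 2 * q ^ d.+1 * 'C(c + d, d.+1)
     + d * 'C(c.-1 + d, d) * q ^ d =
   'C(2 * c * q + d, d.+1) + d * 'C(c.-1 + d, d) * q ^ d.+1)%N.
Proof.
move=> q0 dc.
pose H := box_sum d (2 * c) (fun s => s < c)%N.
pose G := box_sum d (2 * c) (fun s => c - s)%N.
have HE : H = 'C(c.-1 + d, d).
  by rewrite -(@box_sum_lt d c.-1 (2 * c)%N) ?prednK //; lia.
have GE : G = 'C(c + d, d.+1).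
  transitivity (box_sum d (2 * c) (fun t => 'C(c - t + 0, 1))).
    by apply: eq_box_sum => t _; rewrite addn0 bin1.
  by rewrite box_sum_bin ?add0n //; lia.
have UE : box_sum d (2 * c) (fun s => box_sum d q (fun m => 2 * c * q - (q * s + m)))%N
    = 'C(2 * c * q + d, d.+1).
  rewrite -(@box_sum_cells d (2 * c) q (fun t => 2 * c * q - t)%N) //.
  transitivity (box_sum d (2 * c * q) (fun t => 'C(2 * c * q - t + 0, 1))).
    by apply: eq_box_sum => t _; rewrite addn0 bin1.
  by rewrite box_sum_bin ?add0n.
rewrite -HE -GE -UE.
(* On a cell [s < c], [m = (2 c q - m) - 2 (c q - m)], and the mean of [m] there is
   [q s + d (q - 1)/2]. The other cells need no correction. *)
have cell s : (cell_sum d c q s + 2 * q ^ d.+1 * (c - s) + d * (s < c) * q ^ d =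
    box_sum d q (fun m => 2 * c * q - (q * s + m)) + d * (s < c) * q ^ d.+1)%N.
  rewrite /cell_sum /cell_weight; case: ltnP => sc; last first.
    have -> : (c - s = 0)%N by lia.
    by rewrite !muln0 !mul0n !addn0.
  have E : (box_sum d q (fun m => q * s + m) + (2 * c * q) * q ^ d =
     box_sum d q (fun m => 2 * c * q - (q * s + m)) + 2 * box_sum d q (fun m => q * s + m))%N.
    rewrite [(2 * c * q * _)%N]mulnC -box_sum_const -box_sumM -!box_sumD.
    by apply: eq_box_sum => m le; nia.
  have F : box_sum d q (fun m => q * s + m)%N = (q ^ d * (q * s) + box_sum d q id)%N.
    by rewrite box_sumD box_sum_const.
  have := box_sum_id q; rewrite F in E *; rewrite !expnS; nia.
have := eq_box_sum (d := d) (N := (2 * c)%N) (fun s _ => cell s).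
rewrite !box_sumD (box_sumM _ _ (2 * q ^ d.+1)%N (fun s => c - s)%N) -/G.
have HM x : box_sum d (2 * c) (fun s => d * (s < c) * x)%N = (d * H * x)%N.
  rewrite -mulnA [(H * x)%N]mulnC mulnA -box_sumM; apply: eq_box_sum => s _.
  by rewrite -mulnA [((s < c) * x)%N]mulnC mulnA.
by rewrite !HM.
Qed.

Lemma rees_count_value (q : nat -> nat) : to_infty R q -> (d <= c.+1)%N ->
  (fun e => (rees_count d c (q e))%:R / (q e ^ d.+1)%:R : R) @ \oo -->
  (((2 * c)%:R ^+ d.+1 / d.+1`!%:R + d%:R * 'C(c.-1 + d, d)%:R
    - 2 * 'C(c + d, d.+1)%:R) / c%:R ^+ 2 : R).
Proof.
move=> qi dc; apply: cvg_rees_count => //.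
have c2 : (0 < 2 * c)%N by rewrite muln_gt0.
have [q0 qV] := qi.
have L1 := cvg_bin (k := d) (to_inftyM c2 qi).
(* The identity [cell_sum_value] divided by [q^(d+1)]; its term in [q^d] becomes the multiple of
   [1/q]. *)
pose f e : R := 'C(2 * c * q e + d, d.+1)%:R / ((2 * c * q e) ^ d.+1)%:R * (2 * c)%:R ^+ d.+1
   + d%:R * 'C(c.-1 + d, d)%:R - 2 * 'C(c + d, d.+1)%:R
   + (- (d%:R * 'C(c.-1 + d, d)%:R)) * (q e)%:R^-1.
have -> : (fun e => (box_sum d (2 * c) (cell_sum d c (q e)))%:R / (q e ^ d.+1)%:R) = f.
  apply/funext => e; have qe := q0 e.
  have qR : (q e)%:R != 0 :> R by rewrite pnatr_eq0 -lt0n.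
  have cR : (2 * c)%:R != 0 :> R by rewrite pnatr_eq0 -lt0n.
  have := congr1 (fun x => x%:R : R) (cell_sum_value qe dc).
  rewrite !natrD !natrM !natrX /f expnMn [((2 * c) ^ _ * _)%:R]natrM !natrX.
  move: (box_sum d _ _)%:R ('C(2 * c * q e + d, d.+1))%:R => X B.
  have cD : (2 * c)%:R ^+ d.+1 != 0 :> R by rewrite expf_neq0.
  have qD : (q e)%:R ^+ d != 0 :> R by rewrite expf_neq0.
  move: ((2 * c)%:R ^+ d.+1) cD => C cD; rewrite !exprS.
  move: ((q e)%:R ^+ d) qD => y qD eX.
  have -> : X = B + d%:R * 'C(c.-1 + d, d)%:R * ((q e)%:R * y)
    - 2 * ((q e)%:R * y) * 'C(c + d, d.+1)%:R - d%:R * 'C(c.-1 + d, d)%:R * y.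
    by rewrite -eX; ring.
  by field; rewrite ?qR ?cD ?qD.
have : f @ \oo --> (d.+1`!%:R^-1 * (2 * c)%:R ^+ d.+1
   + d%:R * 'C(c.-1 + d, d)%:R - 2 * 'C(c + d, d.+1)%:R
   + (- (d%:R * 'C(c.-1 + d, d)%:R)) * 0 : R).
  apply: cvgD; last by apply: cvgM => //; exact: cvg_cst.
  apply: cvgB; last exact: cvg_cst.
  apply: cvgD; last exact: cvg_cst.
  by apply: cvgM => //; exact: cvg_cst.
by rewrite mulr0 addr0 [_^-1 * _]mulrC.
Qed.

(** [c] times the count is asymptotic to [(c n)^d / d!], so [c^d / c] remains. *)
Lemma veronese_count_cvg :
  (fun n => d`!%:R / (n ^ d)%:R * (veronese_count d c n)%:R : R) @ \oo --> (c%:R ^+ d.-1 : R).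
Proof.
(* The estimate on the count requires [n > 0]. *)
rewrite -cvg_shiftS /=.
have ci := to_inftyM c_gt0 (to_inftyS R).
have cR : c%:R != 0 :> R by rewrite pnatr_eq0 -lt0n.
have L1 := cvg_bin (k := d.-1) ci; rewrite prednK // in L1.
have L2 : (fun n => (c * veronese_count d c n.+1)%:R / ((c * n.+1) ^ d)%:R : R) @ \oo
    --> (d`!%:R^-1 : R).
  have := @cvg_close R (2 * c) d.-1 (fun n => c * n.+1)%N
    (fun n => c * veronese_count d c n.+1)%N (fun n => 'C(c * n.+1 + d.-1, d)) _ ci.
  rewrite prednK //; apply=> // n.
  have := veronese_count_close d_gt0 c_gt0 (ltn0Sn n); rewrite mulnC.
  have -> // : ((c * n.+1).-1 + d = c * n.+1 + d.-1)%N.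
  by case: (d) d_gt0 => // d' _; rewrite addnS -addSn prednK ?muln_gt0 ?c_gt0.
have -> : (fun n => d`!%:R / (n.+1 ^ d)%:R * (veronese_count d c n.+1)%:R : R) =
   (fun n => (c * veronese_count d c n.+1)%:R / ((c * n.+1) ^ d)%:R * (d`!%:R * c%:R ^+ d.-1)).
  apply/funext => n; rewrite expnMn !natrM.
  have -> : (c ^ d)%:R = c%:R * c%:R ^+ d.-1 :> R by rewrite -exprS prednK // natrX.
  have nR : (n.+1 ^ d)%:R != 0 :> R by rewrite pnatr_eq0 expn_eq0.
  have cD : c%:R ^+ d.-1 != 0 :> R by rewrite expf_neq0.
  by field; rewrite ?nR ?cR ?cD.
have := cvgM L2 (cvg_cst (d`!%:R * c%:R ^+ d.-1 : R)).
rewrite mulrA mulVf ?mul1r; first exact.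
by rewrite pnatr_eq0 -lt0n fact_gt0.
Qed.

End LengthLimits.

(** * Values of the two multiplicities *)

Section Invariants.
Variable R : realType.

(** [eHK] is a choice by [xget]; uniqueness of dimension, lengths and limit identifies it with any
    value that has been exhibited. *)
Lemma has_eHK_unique p (B : comNzRingType) (n : {pred B}) (l l' : R) :
  has_eHK p n l -> has_eHK p n l' -> l = l'.
Proof.
move=> [D [len [[Dc Dm] lenP lim]]] [D' [len' [[Dc' Dm'] lenP' lim']]].
have DD : D = D' by apply/eqP; rewrite eqn_leq Dm' ?Dm.
have ll : len = len'.
  apply/funext => e; have [c1 m1] := lenP e; have [c2 m2] := lenP' e.
  by apply/eqP; rewrite eqn_leq m1 ?m2.
rewrite DD ll in lim; exact: (cvg_unique _ lim lim').
Qed.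

Lemma has_mult_unique d (A : comNzRingType) (m : {pred A}) (l l' : R) :
  has_mult d m l -> has_mult d m l' -> l = l'.
Proof.
move=> [len [lenP lim]] [len' [lenP' lim']].
have ll : len = len'.
  apply/funext => e; have [c1 m1] := lenP e; have [c2 m2] := lenP' e.
  by apply/eqP; rewrite eqn_leq m1 ?m2.
rewrite ll in lim; exact: (cvg_unique _ lim lim').
Qed.

Lemma eHK_val p (B : comNzRingType) (n : {pred B}) (l : R) :
  has_eHK p n l -> eHK R p n = l.
Proof. by move=> H; apply: xget_subset1 => // x y; exact: has_eHK_unique. Qed.

Lemma mult_val d (A : comNzRingType) (m : {pred A}) (l : R) :
  has_mult d m l -> mult R d m = l.
Proof. by move=> H; apply: xget_subset1 => // x y; exact: has_mult_unique. Qed.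

Variables (k : fieldType) (p : nat) (p_char : p \in [pchar k]).
Variables (d : nat) (d_gt0 : (0 < d)%N).

Lemma has_eHK_rees_lim c (c_gt0 : (0 < c)%N) (l : R) :
  (fun e => (rees_count d c (p ^ e))%:R / ((p ^ e) ^ d.+1)%:R) @ \oo --> l ->
  has_eHK_rees k d p c_gt0 l.
Proof.
move=> H; exists d.+1, (fun e => rees_count d c (p ^ e)); split=> //.
- exact: rees_krull_dim.
- by move=> e; exact: rees_length.
Qed.

Lemma has_eHK_rees_ex c (c_gt0 : (0 < c)%N) : exists l : R, has_eHK_rees k d p c_gt0 l.
Proof.
have [l H] := rees_count_is_cvg R d_gt0 c_gt0 (prime_gt1 (pcharf_prime p_char)).
by exists l; exact: has_eHK_rees_lim.
Qed.

Lemma eHK_rees_val c (c_gt0 : (0 < c)%N) : (d <= c.+1)%N ->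
  eHK_rees R k d p c_gt0 =
  ((2 * c)%:R ^+ d.+1 / d.+1`!%:R + d%:R * 'C(c.-1 + d, d)%:R
    - 2 * 'C(c + d, d.+1)%:R) / c%:R ^+ 2.
Proof.
move=> dc; apply: eHK_val; apply: has_eHK_rees_lim.
apply: rees_count_value => //; apply: to_infty_exp.
exact: prime_gt1 (pcharf_prime p_char).
Qed.

Lemma has_mult_veronese_pow c (c_gt0 : (0 < c)%N) :
  has_mult_veronese k d c (c%:R ^+ d.-1 : R).
Proof.
exists (veronese_count d c); split; first by move=> n; exact: veronese_length.
exact: veronese_count_cvg.
Qed.

Lemma mult_veronese_val c (c_gt0 : (0 < c)%N) :
  mult_veronese R k d c = c%:R ^+ d.-1.
Proof. by apply: mult_val; exact: has_mult_veronese_pow. Qed.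

End Invariants.

(** * The two inequalities in [d] and [c], and the theorem *)

(** Applied with [n = d + 1]; it fails at [n = 3], which is where the strict inequality asks for
    [d >= 3]. *)
Lemma exp2_lt_fact n : (3 < n)%N -> (2 ^ n < n`!)%N.
Proof.
elim: n => // n IH; rewrite ltnS leq_eqVlt => /orP[/eqP <- //|lt].
rewrite expnS factS; apply: leq_trans (_ : 2 * n`! <= _)%N.
  by rewrite ltn_pmul2l // IH.
by rewrite leq_mul2r orbC -(ltn_predK lt).
Qed.

(** Since [(d + 1) C(c+d, d+1) = (c + d) C(c+d-1, d)], the claim reduces to
    [d (d + 1) <= 2 (c + d)], that is, to [d (d - 1) <= 2 c]. *)
Lemma bin_tail_le c d : (0 < c)%N -> (d * d.-1 <= 2 * c)%N ->
  (d * 'C(c.-1 + d, d) <= 2 * 'C(c + d, d.+1))%N.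
Proof.
move=> c0 dc; rewrite -(leq_pmul2l (ltn0Sn d)).
rewrite [leqRHS]mulnCA -mul_bin_diag.
have -> : (c + d).-1 = (c.-1 + d)%N by lia.
rewrite !mulnA leq_mul2r; apply/orP; right.
by case: d dc => [|d] //=; nia.
Qed.

Theorem corollary5p4 (R : realType) (k : fieldType) (p : nat)
    (p_char : p \in [pchar k]) (d : nat) (d_ge3 : (3 <= d)%N) :
  [/\ (* the two multiplicities are well defined *)
      forall (c : nat) (c_gt0 : (0 < c)%N),
        has_eHK_rees k d p c_gt0 (eHK_rees R k d p c_gt0) /\
        has_mult_veronese k d c (mult_veronese R k d c),
      forall (c : nat) (c_gt0 : (0 < c)%N),
        (d%:R * (d%:R - 1) / 2 <= c%:R :> R) ->
        [/\ eHK_rees R k d p c_gt0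
              <= 2 ^+ (d + 1) / ((d + 1)`!)%:R * c%:R ^+ (d - 1),
            2 ^+ (d + 1) / ((d + 1)`!)%:R * c%:R ^+ (d - 1)
              < c%:R ^+ (d - 1) :> R &
            c%:R ^+ (d - 1) = mult_veronese R k d c]
    & (fun n : nat => eHK_rees R k d p (ltn0Sn n) / mult_veronese R k d n.+1)
        @ \oo --> ((2 ^+ (d + 1) - 2) / ((d + 1)`!)%:R : R)].
Proof.
have d0 : (0 < d)%N by exact: leq_trans d_ge3.
rewrite addn1 subn1; split.
- move=> c c0; split; last first.
    by rewrite mult_veronese_val //; exact: has_mult_veronese_pow.
  have [l lP] := has_eHK_rees_ex R p_char d0 c0.
  by rewrite /eHK_rees (eHK_val lP).
- move=> c c0 dc; have cR : (0 : R) < c%:R by rewrite ltr0n.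
  have fR : (0 : R) < d.+1`!%:R by rewrite ltr0n fact_gt0.
  have ddc : (d * d.-1 <= 2 * c)%N.
    move: dc; rewrite ler_pdivrMr // -{2}(prednK d0) -natr1 addrK -!natrM ler_nat.
    by rewrite [(c * 2)%N]mulnC.
  split; last by rewrite mult_veronese_val.
  (* The closed formula applies: [2 (d - 1) <= d (d - 1) <= 2 c] gives [d <= c + 1]. *)
  + rewrite eHK_rees_val //; last by nia.
    rewrite ler_pdivrMr ?exprn_gt0 // -addrA.
    have -> : 2 ^+ d.+1 / d.+1`!%:R * c%:R ^+ d.-1 * c%:R ^+ 2 =
        (2 * c)%:R ^+ d.+1 / d.+1`!%:R :> R.
      have cE : c%:R ^+ d.+1 = c%:R ^+ d.-1 * c%:R ^+ 2 :> R.
        by rewrite -exprD addn2 prednK.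
      by rewrite natrM exprMn cE; ring.
    rewrite gerDl subr_le0 -!natrM ler_nat; exact: bin_tail_le.
  + rewrite -[ltRHS]mul1r ltr_pM2r ?exprn_gt0 // ltr_pdivrMr // mul1r.
    by rewrite -natrX ltr_nat exp2_lt_fact.
have L1 := cvg_bin (k := d) (to_inftyS R).
have L2 := cvg_bin (k := d.-1) (to_inftyS R); rewrite prednK // in L2.
(* The closed formula over [c^(d-1)] with [c = n + 1]. The middle binomial has degree only [d] in
   [c], which leaves the factor [1/c]. *)
pose f (n : nat) : R := 2 ^+ d.+1 / d.+1`!%:R
  + d%:R * ('C(n.+1 + d.-1, d)%:R / (n.+1 ^ d)%:R) * n.+1%:R^-1
  - 2 * ('C(n.+1 + d, d.+1)%:R / (n.+1 ^ d.+1)%:R).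
have fl : f @ \oo --> (2 ^+ d.+1 / d.+1`!%:R + d%:R * d`!%:R^-1 * 0
    - 2 * d.+1`!%:R^-1 : R).
  apply: cvgB; last by apply: cvgM => //; exact: cvg_cst.
  apply: cvgD; first exact: cvg_cst.
  by apply: cvgM; [apply: cvgM => //; exact: cvg_cst|exact: (to_inftyS R).2].
rewrite mulrBl; rewrite mulr0 addr0 in fl.
(* The ratio equals [f] only once [d <= c + 1], hence an eventual equality. *)
apply: cvg_trans fl; apply: near_eq_cvg; near=> n.
have nd : (d <= n.+2)%N by near: n; exists d => // m /= dm; lia.
rewrite /f eHK_rees_val // mult_veronese_val //.
have nR : n.+1%:R != 0 :> R by rewrite pnatr_eq0.
have fR : d.+1`!%:R != 0 :> R by rewrite pnatr_eq0 -lt0n fact_gt0.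
have -> : (n.+1 + d.-1)%N = (n.+1.-1 + d)%N by lia.
have dE : n.+1%:R ^+ d = n.+1%:R * n.+1%:R ^+ d.-1 :> R by rewrite -exprS prednK.
have dE1 : n.+1%:R ^+ d.+1 = n.+1%:R ^+ 2 * n.+1%:R ^+ d.-1 :> R.
  by rewrite -exprD add2n prednK.
have nD : n.+1%:R ^+ d.-1 != 0 :> R by rewrite expf_neq0.
rewrite !natrX natrM exprMn dE1 dE {L1 L2 f dE dE1}.
move: (n.+1%:R ^+ d.-1) nD (n.+1%:R) nR => y nD x nR.
by move: d.+1`!%:R fR => F fR; field; rewrite ?nR ?fR ?nD ?expf_neq0.
Unshelve. all: by end_near.
Qed.
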